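(* Let $\mathcal H_1,\mathcal H_2$ be Hilbert spaces, $A$ a self-adjoint operator in $\mathcal H_1$ bounded from below, $B$ a densely defined closable operator from $\mathcal H_2$ to $\mathcal H_1$, and $D$ a self-adjoint operator in $\mathcal H_2$ bounded from above; let $\mathfrak a$, $\mathfrak d$ be the closed quadratic forms associated with $A$, $D$. Assume that $\mathrm{dom}(\mathfrak a)\subset\mathrm{dom}(B^* )$ and that either (I) $\mathrm{dom}(B)\subset\mathrm{dom}(D)$ and $\mathrm{dom}(B)$ is a core for $D$, or (II) $\mathrm{dom}(\mathfrak d)\subset\mathrm{dom}(B)$. Let $\mathcal M$ be the closure of $\mathcal M_0=\begin{pmatrix}A&B\\-B^*&D\end{pmatrix}$ with $\mathrm{dom}(\mathcal M_0)=(\mathrm{dom}(A)\cap\mathrm{dom}(B^* ))\times(\mathrm{dom}(B)\cap\mathrm{dom}(D))$ in $\mathcal H_1\oplus\mathcal H_2$. Let $a\in\mathbb R$, $b\ge0$ be such that $\|B^*x\|^2\le a\|x\|^2+b\,\mathfrak a[x]$ for all $x\in\mathrm{dom}(\mathfrak a)$, let $\delta_+=\max\sigma(D)$ and $\mu=\delta_++b+\sqrt{\max\{b\delta_++b^2+a,0\}}$. Then all points from $\sigma(\mathcal M)\cap(\mu,\infty)$ are spectral points of positive type of $\mathcal M$.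
   Context: Hilbert spaces are non-zero and complex. $\mathfrak a$ has domain $\mathrm{dom}(|A|^{1/2})$ and $\mathfrak a[x]=\mathfrak a[x,x]$; $\mathfrak d$ has domain $\mathrm{dom}(|D|^{1/2})$. Under the stated assumptions $\mathcal M_0$ is closable and such $a,b$ exist. $\mathcal H_1\oplus\mathcal H_2$ is equipped with the indefinite inner product $\bigl[\binom{x}{y},\binom{\hat x}{\hat y}\bigr]=\langle x,\hat x\rangle-\langle y,\hat y\rangle$. The approximate point spectrum $\sigma_{\rm app}(\mathcal M)$ is the set of $\lambda\in\mathbb C$ for which there are $w_n\in\mathrm{dom}(\mathcal M)$, $\|w_n\|=1$, with $(\mathcal M-\lambda)w_n\to0$. A point $\lambda\in\sigma_{\rm app}(\mathcal M)$ is called a spectral point of positive type if for every sequence $(x_n,y_n)^T\in\mathrm{dom}(\mathcal M)$ with $(\mathcal M-\lambda)\binom{x_n}{y_n}\to0$ and $\|x_n\|^2+\|y_n\|^2=1$ one has $\liminf_{n\to\infty}\bigl[\binom{x_n}{y_n},\binom{x_n}{y_n}\bigr]>0$. *)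

(* Defs.v *)
From HB Require Import structures.
From mathcomp Require Import all_boot all_order all_algebra.
From mathcomp Require Import complex ring.
From mathcomp Require Import all_classical all_reals all_analysis.

Set Implicit Arguments.
Unset Strict Implicit.
Unset Printing Implicit Defensive.

Import Order.TTheory GRing.Theory Num.Theory.
Import numFieldNormedType.Exports.

Local Open Scope classical_set_scope.
Local Open Scope ring_scope.
Local Open Scope complex_scope.

(* The inner product is linear in its first argument. *)
HB.mixin Record NormedModule_isHilbert (R : realType) V
    & CompleteNormedModule R[i] V := {
  inner : V -> V -> R[i] ;
  inner_linearl : forall (c : R[i]) (x y z : V),
    inner (c *: x + y) z = c * inner x z + inner y z ;
  inner_conj : forall x y : V, inner x y = Num.conj (inner y x) ;
  inner_norm : forall x : V, inner x x = `|x| ^+ 2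
}.

#[short(type="hilbertType")]
HB.structure Definition Hilbert (R : realType) :=
  {V of CompleteNormedModule R[i] V & NormedModule_isHilbert R V}.

Section inner.
Context (R : realType) (V : hilbertType R).
Implicit Types x y z : V.

Let inner_linear_l z : linear_for *%R ((@inner R V)^~ z).
Proof. by move=> c x y; rewrite inner_linearl. Qed.

Let inner_linear_r x : linear_for (Num.conj \; *%R) (@inner R V x).
Proof.
move=> c y z; rewrite inner_conj inner_linearl rmorphD rmorphM/=.
by rewrite -!inner_conj.
Qed.

HB.instance Definition _ := bilinear_isBilinear.Build R[i] V V R[i]
  *%R (Num.conj \; *%R) (@inner R V) (inner_linear_l, inner_linear_r).

Let inner_herm x y : inner x y = (-1) ^+ false * Num.conj (inner y x).
Proof. by rewrite mul1r -inner_conj. Qed.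

HB.instance Definition _ := isHermitianSesquilinear.Build R[i] V false
  Num.conj (@inner R V) inner_herm.

Let inner_gt0 x : x != 0 -> 0 < inner x x.
Proof. by move=> x0; rewrite inner_norm exprn_gt0// normr_gt0. Qed.

HB.instance Definition _ := isDotProduct.Build R[i] V (@inner R V)
  inner_gt0.

End inner.

(* The orthogonal sum; an alias is needed because the library norm on a product
   type is the maximum norm. *)
Definition hsum (R : realType) (H1 H2 : hilbertType R) : Type := (H1 * H2)%type.

Section hsum.
Context (R : realType) (H1 H2 : hilbertType R).
Local Notation W := (hsum H1 H2).
Implicit Types v w : W.

HB.instance Definition _ := GRing.Lmodule.copy W (H1 * H2)%type.

Definition hsum_norm w : R[i] := sqrtC (`|w.1| ^+ 2 + `|w.2| ^+ 2).

Let hsum_sq_ge0 w : 0 <= `|w.1| ^+ 2 + `|w.2| ^+ 2 :> R[i].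
Proof. by rewrite addr_ge0// exprn_ge0. Qed.

Let hsum_norm_ge0 w : 0 <= hsum_norm w.
Proof. by rewrite sqrtC_ge0. Qed.

Lemma hsum_norm_sqr w : hsum_norm w ^+ 2 = `|w.1| ^+ 2 + `|w.2| ^+ 2.
Proof. by rewrite sqrtCK. Qed.

Let ler_of_sqr (x y : R[i]) : 0 <= x -> 0 <= y -> x ^+ 2 <= y ^+ 2 -> x <= y.
Proof. by move=> x0 y0; rewrite ler_pXn2r. Qed.

Let hsum_normD v w : hsum_norm (v + w) <= hsum_norm v + hsum_norm w.
Proof.
apply: ler_of_sqr; rewrite ?addr_ge0//.
set N1 := hsum_norm v; set N2 := hsum_norm w.
rewrite sqrrD !hsum_norm_sqr.
apply: (@le_trans _ _ ((`|v.1| + `|w.1|) ^+ 2 + (`|v.2| + `|w.2|) ^+ 2)).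
  by apply: lerD; rewrite ler_pXn2r ?nnegrE ?addr_ge0 ?ler_normD.
have CS : `|v.1| * `|w.1| + `|v.2| * `|w.2| <= N1 * N2.
  apply: ler_of_sqr; rewrite ?addr_ge0 ?mulr_ge0//; try exact: hsum_norm_ge0.
  rewrite exprMn !hsum_norm_sqr -subr_ge0.
  rewrite [leRHS](_ : _ = (`|v.1| * `|w.2| - `|v.2| * `|w.1|) ^+ 2); last by ring.
  by rewrite real_exprn_even_ge0// rpredB// rpredM// normr_real.
rewrite -subr_ge0 [leRHS](_ : _ =
  (N1 * N2 - (`|v.1| * `|w.1| + `|v.2| * `|w.2|)) *+ 2); last by ring.
by rewrite mulrn_wge0// subr_ge0.
Qed.

Let hsum_normZ (c : R[i]) w : hsum_norm (c *: w) = `|c| * hsum_norm w.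
Proof.
by rewrite /hsum_norm !normrZ !exprMn -mulrDr rootCMl ?exprn_ge0// sqrCK.
Qed.

Let hsum_norm0_eq0 w : hsum_norm w = 0 -> w = 0.
Proof.
move=> w0; have /eqP := hsum_norm_sqr w.
rewrite w0 expr0n/= eq_sym paddr_eq0 ?exprn_ge0// !sqrf_eq0 !normr_eq0.
by case: w {w0} => x y /= /andP[/eqP-> /eqP->].
Qed.

HB.instance Definition _ := Lmodule_isNormed.Build R[i] W
  hsum_normD hsum_normZ hsum_norm0_eq0.

Lemma hsum_normE w : `|w| = sqrtC (`|w.1| ^+ 2 + `|w.2| ^+ 2).
Proof. by []. Qed.

Let fst_norm_le w : `|w.1| <= `|w|.
Proof.
apply: ler_of_sqr => //.
by rewrite [leRHS]hsum_norm_sqr lerDl exprn_ge0.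
Qed.

Let snd_norm_le w : `|w.2| <= `|w|.
Proof.
apply: ler_of_sqr => //.
by rewrite [leRHS]hsum_norm_sqr lerDr exprn_ge0.
Qed.

Let norm_le_sum w : `|w| <= `|w.1| + `|w.2|.
Proof.
apply: ler_of_sqr; rewrite ?addr_ge0//.
rewrite [leLHS]hsum_norm_sqr sqrrD addrAC lerDl.
by rewrite mulrn_wge0// mulr_ge0.
Qed.

Let hsum_complete (F : set_system W) : ProperFilter F -> cauchy F -> cvg F.
Proof.
move=> FF /cauchyP Fc.
have c1 : cauchy ((fun w : W => w.1) @ F).
  apply/cauchyP => e /Fc[w Fw]; exists w.1.
  change (F [set v : W | ball w.1 e v.1]).
  apply: filterS Fw => v; rewrite -!ball_normE/=; apply: le_lt_trans.
  exact: (fst_norm_le (w - v)).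
have c2 : cauchy ((fun w : W => w.2) @ F).
  apply/cauchyP => e /Fc[w Fw]; exists w.2.
  change (F [set v : W | ball w.2 e v.2]).
  apply: filterS Fw => v; rewrite -!ball_normE/=; apply: le_lt_trans.
  exact: (snd_norm_le (w - v)).
have /cvg_ex[x Fx] : cvg ((fun w : W => w.1) @ F) by exact: cauchy_cvg.
have /cvg_ex[y Fy] : cvg ((fun w : W => w.2) @ F) by exact: cauchy_cvg.
apply/cvg_ex; exists ((x, y) : W); apply/cvgrPdist_lt => e e0.
have e20 : 0 < e / 2 by rewrite divr_gt0.
move/cvgrPdist_lt : Fx => /(_ _ e20) Fx.
move/cvgrPdist_lt : Fy => /(_ _ e20) Fy.
near=> w; apply: (le_lt_trans (norm_le_sum _)).
by rewrite [e]splitr ltrD//=; near: w.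
Unshelve. all: by end_near. Qed.

HB.instance Definition _ := Uniform_isComplete.Build W hsum_complete.

Definition hsum_inner v w : R[i] := inner v.1 w.1 + inner v.2 w.2.

Let hsum_inner_linearl (c : R[i]) u v w :
  hsum_inner (c *: u + v) w = c * hsum_inner u w + hsum_inner v w.
Proof. by rewrite /hsum_inner !inner_linearl mulrDr addrACA. Qed.

Let hsum_inner_conj v w : hsum_inner v w = Num.conj (hsum_inner w v).
Proof. by rewrite /hsum_inner rmorphD/= -!inner_conj. Qed.

Let hsum_inner_norm w : hsum_inner w w = `|w| ^+ 2.
Proof. by rewrite [RHS]hsum_norm_sqr /hsum_inner !inner_norm. Qed.

HB.instance Definition _ := NormedModule_isHilbert.Build R W
  hsum_inner_linearl hsum_inner_conj hsum_inner_norm.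

Definition indef_inner v w : R[i] := inner v.1 w.1 - inner v.2 w.2.

End hsum.

(* The values of an operator outside its domain are irrelevant, so operators are
   compared with [op_eq]. *)
Record operator (U V : Type) := Operator { dom : set U ; op_fun :> U -> V }.

Section operators.
Context (R : realType).
Implicit Types H K L : hilbertType R.

Definition op_eq H K (S T : operator H K) : Prop :=
  dom S = dom T /\ forall x, dom T x -> S x = T x.

Definition op_comp H K L (S : operator K L) (T : operator H K) : operator H L :=
  Operator [set x | dom T x /\ dom S (T x)] (fun x => S (T x)).

Definition restriction H K (T : operator H K) (E : set H) : operator H K :=
  Operator (dom T `&` E) T.

Definition op_shift H (T : operator H H) (z : R[i]) : operator H H :=
  Operator (dom T) (fun x => T x - z *: x).

Definition linear_op H K (T : operator H K) : Prop :=
  dom T 0 /\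
  forall (c : R[i]) (x y : H), dom T x -> dom T y ->
    dom T (c *: x + y) /\ T (c *: x + y) = c *: T x + T y.

Definition densely_defined H K (T : operator H K) : Prop := dense (dom T).

(* The vector [z] is unique when [T] is densely defined. *)
Definition adjoint H K (T : operator H K) : operator K H :=
  let adj y := [set z | forall x, dom T x -> inner (T x) y = inner x z] in
  Operator [set y | adj y !=set0] (fun y => xget 0 (adj y)).

Definition op_graph H K (T : operator H K) : set (H * K) :=
  [set p | dom T p.1 /\ T p.1 = p.2].

Definition closable H K (T : operator H K) : Prop :=
  forall y, closure (op_graph T) (0, y) -> y = 0.

Definition op_closure H K (T : operator H K) : operator H K :=
  let lim x := [set y | closure (op_graph T) (x, y)] in
  Operator [set x | lim x !=set0] (fun x => xget 0 (lim x)).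

Definition is_core H K (E : set H) (T : operator H K) : Prop :=
  E `<=` dom T /\ op_eq (op_closure (restriction T E)) T.

Definition self_adjoint H (T : operator H H) : Prop :=
  [/\ linear_op T, densely_defined T & op_eq (adjoint T) T].

Definition bounded_below H (T : operator H H) : Prop :=
  exists c : R, forall x, dom T x -> c%:C * `|x| ^+ 2 <= inner (T x) x.

Definition bounded_above H (T : operator H H) : Prop :=
  exists c : R, forall x, dom T x -> inner (T x) x <= c%:C * `|x| ^+ 2.

Definition resolvent_set H (T : operator H H) : set R[i] :=
  [set z | (forall y, exists! x, dom T x /\ op_shift T z x = y) /\
    exists C : R, forall x, dom T x -> `|x| <= C%:C * `|op_shift T z x|].

Definition spectrum H (T : operator H H) : set R[i] := ~` resolvent_set T.

Definition app_spectrum H (T : operator H H) : set R[i] :=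
  [set z | exists w : nat -> H,
    (forall n, dom T (w n) /\ `|w n| = 1) /\
    op_shift T z (w n) @[n --> \oo] --> (0 : H)].

(* Since [<=] on [R[i]] relates only numbers with the same imaginary part, the
   second condition includes that the spectrum is real. *)
Definition max_spectrum H (T : operator H H) (d : R) : Prop :=
  spectrum T d%:C /\ forall z, spectrum T z -> z <= d%:C.

(* [S] is the nonnegative self-adjoint square root of [T]. *)
Definition sqrt_op H (T S : operator H H) : Prop :=
  [/\ self_adjoint S, forall x, dom S x -> 0 <= inner (S x) x &
      op_eq (op_comp S S) T].

(* [S] is |T|^{1/2}, where |T| = (T^* T)^{1/2} is the operator [P]. *)
Definition sqrt_abs_op H (T S : operator H H) : Prop :=
  exists2 P : operator H H, sqrt_op (op_comp (adjoint T) T) P & sqrt_op P S.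

End operators.

Record qform (R : realType) (U : Type) :=
  QForm { fdom : set U ; qform_fun :> U -> U -> R[i] }.

Section forms.
Context (R : realType) (H : hilbertType R).
Implicit Types (T : operator H H) (q : qform R H).

Definition hermitian_form q : Prop :=
  [/\ fdom q 0,
      forall (c : R[i]) x y, fdom q x -> fdom q y -> fdom q (c *: x + y),
      forall (c : R[i]) x y z, fdom q x -> fdom q y -> fdom q z ->
        q (c *: x + y) z = c * q x z + q y z &
      forall x y, fdom q x -> fdom q y -> q x y = Num.conj (q y x)].

Definition semibounded_form q : Prop :=
  exists c : R,
    (forall x, fdom q x -> c%:C * `|x| ^+ 2 <= q x x) \/
    (forall x, fdom q x -> q x x <= c%:C * `|x| ^+ 2).

Definition closed_form q : Prop :=
  forall (u : nat -> H) (x : H),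
    (forall n, fdom q (u n)) -> u n @[n --> \oo] --> x ->
    (forall e : R, 0 < e -> exists N, forall m n, (N <= m)%N -> (N <= n)%N ->
      `|q (u m - u n) (u m - u n)| < e%:C) ->
    fdom q x /\
    (forall e : R, 0 < e -> exists N, forall n, (N <= n)%N ->
      `|q (u n - x) (u n - x)| < e%:C).

(* The fourth clause (first representation theorem) determines [q] from [T]; the
   last one, dom q = dom |T|^{1/2}, is then the second representation theorem. *)
Definition associated_form T q : Prop :=
  [/\ hermitian_form q, semibounded_form q, closed_form q,
      (forall x z, (dom T x /\ T x = z) <->
         (fdom q x /\ forall y, fdom q y -> q x y = inner z y)) &
      exists2 S : operator H H, sqrt_abs_op T S & fdom q = dom S].

End forms.

Section block.
Context (R : realType) (H1 H2 : hilbertType R).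

Definition block_op (A : operator H1 H1) (B : operator H2 H1)
    (D : operator H2 H2) : operator (hsum H1 H2) (hsum H1 H2) :=
  Operator
    [set w : hsum H1 H2 | (dom A w.1 /\ dom (adjoint B) w.1) /\
                          (dom B w.2 /\ dom D w.2)]
    (fun w => (A w.1 + B w.2, - adjoint B w.1 + D w.2)).

Definition positive_type (M : operator (hsum H1 H2) (hsum H1 H2))
    (z : R[i]) : Prop :=
  app_spectrum M z /\
  forall w : nat -> hsum H1 H2,
    (forall n, dom M (w n)) ->
    op_shift M z (w n) @[n --> \oo] --> (0 : hsum H1 H2) ->
    (forall n, `|(w n).1| ^+ 2 + `|(w n).2| ^+ 2 = 1) ->
    (0 < limn_einf (fun n => (complex.Re (indef_inner (w n) (w n)))%:E))%E.

End block.

(* Main.v *)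
Require Import Defs.
From HB Require Import structures.
From mathcomp Require Import all_boot all_order all_algebra.
From mathcomp Require Import complex ring lra.
From mathcomp Require Import all_classical all_reals all_analysis.

Set Implicit Arguments.
Unset Strict Implicit.
Unset Printing Implicit Defensive.

Import Order.TTheory GRing.Theory Num.Theory.
Import numFieldNormedType.Exports.

Local Open Scope classical_set_scope.
Local Open Scope ring_scope.
Local Open Scope complex_scope.

(** Let [(M - l) w] be small with [w = (x, y)], [k = l - dplus], and
    [z = (l - D) y].  Testing the two rows with [x] and [y] and adding real parts
    gives [a[x] ~ l |x|^2 + <z, y>], while the second row says [B^* x ~ - z].
    Hence [|z|^2 <= a |x|^2 + b (l |x|^2 + <z, y>)] up to small terms, and
    [D <= dplus] turns this into [(k^2 - b k) |y|^2 <= (a + b l) |x|^2].  The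
    condition [l > mu] is exactly [k^2 - b k > max (a + b l) 0] (with [k > b]), so
    [|x|^2 - |y|^2] stays bounded away from [0].

    That [l] is an approximate eigenvalue: otherwise [M - l] has closed range, and
    a vector [(u, v)] orthogonal to the range of [M0 - l] satisfies [u \in dom a]
    (Riesz in the form domain) and [v \in dom D] (core property); approximating
    [v] in the core of [D] and solving for the first component shows that
    [(u, - v)] is in the kernel of [M - l], hence zero, so that [l] is in the
    resolvent set. *)

(** * The Riesz representation theorem for real functionals *)

(** At the minimiser [t = - q / p] the polynomial has the value [(p r - q^2) / p]; if [p = 0] and
    [q] is non-zero it is affine and takes the value [-1]. *)
Lemma quad_ge0_discr (R : realFieldType) (p q r : R) : 0 <= p ->
  (forall t : R, 0 <= t ^+ 2 * p + 2 * t * q + r) -> q ^+ 2 <= p * r.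
Proof.
rewrite le_eqVlt => /predU1P[<- H|p0 H].
  have [->|q0] := eqVneq q 0; first by rewrite expr0n mul0r.
  have := H (- (r + 1) / (2 * q)).
  have -> : (- (r + 1) / (2 * q)) ^+ 2 * 0 + 2 * (- (r + 1) / (2 * q)) * q + r = -1.
    by field.
  by rewrite ler0N1.
have := H (- q / p).
have -> : (- q / p) ^+ 2 * p + 2 * (- q / p) * q + r = (p * r - q ^+ 2) / p.
  by field; rewrite gt_eqF.
by rewrite pmulr_lge0 ?invr_gt0// subr_ge0.
Qed.

(** Stands in for letting [e] tend to [0]; applied to squares, it yields the equalities that are
    obtained by approximation. *)
Lemma le_eps (R : realFieldType) (p c : R) : 0 <= c ->
  (forall e, 0 < e -> p <= e * c) -> p <= 0.
Proof.
move=> c0 H; rewrite leNgt; apply/negP => p0.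
have c1 : 0 < c + 1 by lra.
have := H (p / (2 * (c + 1))); rewrite divr_gt0 ?mulr_gt0// => /(_ isT).
rewrite mulrAC ler_pdivlMr ?mulr_gt0//; nra.
Qed.

Lemma harmonic_lt (R : realType) (e : R) : 0 < e ->
  exists N, forall n, (N <= n)%N -> n.+1%:R^-1 < e.
Proof.
move=> e0; have [N _ HN] := near_infty_natSinv_lt (PosNum e0).
by exists N => n /HN.
Qed.

Section real_riesz.
Context (R : realType) (V : lmodType R[i]).
Implicit Types (P : set V) (g : V -> V -> R) (x y z : V).

(** Convergence in the seminorm of [g], expressed by its square to avoid roots. *)
Definition vanishing g (u : nat -> V) (x : V) : Prop :=
  forall e : R, 0 < e -> exists N, forall n, (N <= n)%N ->
    g (u n - x) (u n - x) < e.

Definition form_cauchy g (u : nat -> V) : Prop :=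
  forall e : R, 0 < e -> exists N, forall m n, (N <= m)%N -> (N <= n)%N ->
    g (u m - u n) (u m - u n) < e.

Definition linear_subspace P : Prop :=
  P 0 /\ forall (c : R[i]) x y, P x -> P y -> P (c *: x + y).

(** Homogeneity over [R] only, although [V] is a complex space: the functionals in question are real
    parts of complex ones. *)
Definition real_linear P (f : V -> R) : Prop :=
  forall (c : R) x y, P x -> P y -> f (c%:C *: x + y) = c * f x + f y.

Definition real_semi_inner P g : Prop :=
  [/\ forall z, P z -> real_linear P (g^~ z),
      forall x y, P x -> P y -> g x y = g y x &
      forall x, P x -> 0 <= g x x].

Section lemmas.
Context (P : set V) (g : V -> V -> R).
Hypotheses (subP : linear_subspace P) (gP : real_semi_inner P g).

Lemma subspaceD x y : P x -> P y -> P (x + y).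
Proof. by move=> Px Py; rewrite -[x]scale1r; apply: subP.2. Qed.

Lemma subspaceZ (c : R[i]) x : P x -> P (c *: x).
Proof. by move=> Px; rewrite -[_ *: _]addr0; apply: subP.2 => //; exact: subP.1. Qed.

Lemma subspaceB x y : P x -> P y -> P (x - y).
Proof. by move=> Px Py; rewrite -scaleN1r; apply: subspaceD => //; exact: subspaceZ. Qed.

Lemma real_linearD f : real_linear P f ->
  forall x y, P x -> P y -> f (x + y) = f x + f y.
Proof. by move=> fl x y Px Py; rewrite -[x]scale1r (fl 1)// mul1r scale1r. Qed.

Lemma real_linear0 f : real_linear P f -> f 0 = 0.
Proof.
move=> fl; have := real_linearD fl subP.1 subP.1.
by rewrite addr0 => /eqP; rewrite -subr_eq subrr => /eqP.
Qed.

Lemma real_linearZ f : real_linear P f ->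
  forall (c : R) x, P x -> f (c%:C *: x) = c * f x.
Proof.
move=> fl c x Px; rewrite -[_ *: _]addr0 (fl c)//; last exact: subP.1.
by rewrite (real_linear0 fl) addr0.
Qed.

Lemma real_linearB f : real_linear P f ->
  forall x y, P x -> P y -> f (x - y) = f x - f y.
Proof.
move=> fl x y Px Py; rewrite addrC -scaleN1r.
by have := fl (-1) y x Py Px; rewrite rmorphN1 => ->; rewrite mulN1r addrC.
Qed.

Lemma form_linl z : P z -> real_linear P (g^~ z). Proof. by case: gP => + _ _; exact. Qed.
Lemma form_sym x y : P x -> P y -> g x y = g y x. Proof. by case: gP => _ + _; exact. Qed.
Lemma form_ge0 x : P x -> 0 <= g x x. Proof. by case: gP => _ _; exact. Qed.

Lemma form_linr z : P z -> real_linear P (g z).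
Proof.
move=> Pz c x y Px Py; have Pcxy := subP.2 c%:C x y Px Py.
by rewrite form_sym// (form_linl Pz)// !(form_sym Pz).
Qed.

Lemma form_sqr c x y : P x -> P y ->
  g (c%:C *: x + y) (c%:C *: x + y) = c ^+ 2 * g x x + 2 * c * g x y + g y y.
Proof.
move=> Px Py; have Pxy := subP.2 c%:C x y Px Py.
rewrite form_linl// !form_linr// (form_sym Py Px); ring.
Qed.

Lemma form_sqrB x y : P x -> P y ->
  g (x - y) (x - y) = g x x - 2 * g x y + g y y.
Proof.
move=> Px Py; rewrite addrC -scaleN1r; have := form_sqr (-1) Py Px.
rewrite rmorphN1 => ->; rewrite (form_sym Py Px); ring.
Qed.

Lemma form_sqrD x y : P x -> P y ->
  g (x + y) (x + y) = g x x + 2 * g x y + g y y.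
Proof.
move=> Px Py; have := form_sqr 1 Px Py.
rewrite scale1r => ->; ring.
Qed.

Lemma form_CauchySchwarz x y : P x -> P y -> g x y ^+ 2 <= g x x * g y y.
Proof.
move=> Px Py; apply: quad_ge0_discr => [|t]; first exact: form_ge0.
by rewrite -form_sqr//; apply: form_ge0; exact: subP.2.
Qed.

Definition form_complete : Prop := forall u : nat -> V,
  (forall n, P (u n)) -> form_cauchy g u -> exists2 x, P x & vanishing g u x.

(* The minimiser of [g x x - 2 f x] over [P]; [euler] is the approximate
   Euler-Lagrange equation satisfied by an approximate minimiser. *)
Theorem real_riesz (f : V -> R) (K : R) : 0 <= K -> form_complete -> real_linear P f ->
  (forall x, P x -> f x ^+ 2 <= K * g x x) ->
  exists2 u, P u & forall x, P x -> f x = g x u.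
Proof.
move=> K0 gc fl fK; pose J x := g x x - 2 * f x.
(* This is [2 f x <= 2 sqrt (K g x x) <= g x x + K], proved by squaring. *)
have Jge x : P x -> - K <= J x.
  move=> Px; have := fK x Px; have := form_ge0 Px; rewrite /J => g0 fxK.
  suff : 2 * f x <= g x x + K by lra.
  have [f0|f0] := leP 0 (f x); last by lra.
  rewrite -(ler_pXn2r (n := 2)) ?nnegrE//; [|lra..].
  by have := sqr_ge0 (g x x - K); lra.
have hasinf : has_inf [set J x | x in P].
  split; first by exists (J 0), 0 => //; exact: subP.1.
  by exists (- K) => _ [x Px <-]; exact: Jge.
pose d := inf [set J x | x in P].
have dJ x : P x -> d <= J x.
  by move=> Px; apply: ge_inf; [exact: hasinf.2|exists x].
(* For every real [t], [J (t y + x) >= d > J x - e]; this is a quadratic inequality in [t], and its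
   discriminant gives the bound. *)
have euler e x y : P x -> P y -> J x < d + e -> (g y x - f y) ^+ 2 <= g y y * e.
  move=> Px Py Je; apply: quad_ge0_discr => [|t]; first exact: form_ge0.
  have := dJ _ (subP.2 t%:C y x Py Px).
  by rewrite /J form_sqr// fl//; move: Je; rewrite /J; lra.
have /choice[u uP] : forall n, exists x, P x /\ J x < d + n.+1%:R^-1.
  move=> n; have n0 : 0 < n.+1%:R^-1 :> R by [].
  by have [_ [x Px <-] Jx] := inf_adherent n0 hasinf; exists x.
have [n|e e0|x Px ux] := gc u.
- by have [] := uP n.
(* With [e / 5] the two bounds from [euler] give [G^2 <= 4 (e / 5) G], which excludes [G >= e]. *)
- have [N HN] := harmonic_lt (divr_gt0 e0 (ltr0n _ 5)).
  exists N => m n Nm Nn.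
  have [Pm Jm] := uP m; have [Pn Jn] := uP n.
  have Pd := subspaceB Pm Pn.
  have Gm : J (u m) < d + e / 5%:R by apply: lt_trans Jm _; rewrite ltrD2l; exact: HN.
  have Gn : J (u n) < d + e / 5%:R by apply: lt_trans Jn _; rewrite ltrD2l; exact: HN.
  have := euler _ _ _ Pm Pd Gm; have := euler _ _ _ Pn Pd Gn.
  have : g (u m - u n) (u m - u n) =
      (g (u m - u n) (u m) - f (u m - u n)) - (g (u m - u n) (u n) - f (u m - u n)).
    by rewrite (real_linearB (form_linr Pd))//; lra.
  set p := g _ (u m) - _; set q := g _ (u n) - _; set G := g _ _ => Gpq Hq Hp.
  rewrite ltNge; apply/negP => eG.
  have : G ^+ 2 <= 4 * (e / 5%:R) * G by rewrite {1}Gpq; nra.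
  by rewrite expr2; nra.
(* Both [f y] and [g y x] are close to [g y (u n)], the first by [euler], the second by
   Cauchy-Schwarz. *)
exists x => // y Py; apply/eqP; rewrite -subr_eq0 -sqrf_eq0 eq_le sqr_ge0 andbT.
apply: (@le_eps _ _ (4 * g y y)); first by rewrite mulr_ge0// form_ge0.
move=> e e0.
have [N1 H1] := harmonic_lt e0; have [N2 H2] := ux e e0.
pose n := maxn N1 N2; have [Pn Jn] := uP n.
have Jne : J (u n) < d + e by apply: lt_trans Jn _; rewrite ltrD2l; apply: H1; exact: leq_maxl.
have Pd := subspaceB Pn Px.
have := euler _ _ _ Pn Py Jne.
have := form_CauchySchwarz Py Pd.
have := H2 n (leq_maxr _ _).
rewrite (real_linearB (form_linr Py))//.
have := form_ge0 Py; have := form_ge0 Pd.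
set p := g y (u n); set q := g y x; set F := f y; set G := g y y; set D := g _ _.
move=> D0 G0 De Hp Hq.
have GD : G * D <= G * e by rewrite ler_wpM2l// ltW.
suff : (F - q) ^+ 2 <= 2 * (p - F) ^+ 2 + 2 * (p - q) ^+ 2 by lra.
have := sqr_ge0 ((p - F) + (p - q)); lra.
Qed.

End lemmas.
End real_riesz.

(** * Hilbert spaces *)

Section hilbert.
Context (R : realType) (V : hilbertType R).
Implicit Types (P : set V) (x y z : V).

(** Estimates are carried out in [R], with real parts and squared norms, because the order of [R[i]]
    is only partial. *)
Definition rip x y : R := complex.Re (inner x y).
Definition sq x : R := rip x x.

Lemma Re_realM (c : R) (z : R[i]) : complex.Re (c%:C * z) = c * complex.Re z.
Proof. by case: z => p q /=; rewrite mul0r subr0. Qed.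

Lemma inner_linearr (c : R[i]) x y z :
  inner z (c *: x + y) = Num.conj c * inner z x + inner z y.
Proof. by rewrite inner_conj inner_linearl rmorphD rmorphM/= -!inner_conj. Qed.

Lemma innerBr x y z : inner z (x - y) = inner z x - inner z y.
Proof. by rewrite addrC -scaleN1r inner_linearr rmorphN1 mulN1r addrC. Qed.

Lemma innerZl (c : R[i]) x z : inner (c *: x) z = c * inner x z.
Proof. exact: linearZl_LR. Qed.

Lemma ripC x y : rip x y = rip y x.
Proof. by rewrite /rip inner_conj; case: (inner y x). Qed.

Lemma rip_linear P z : real_linear P (rip^~ z).
Proof. by move=> c x y _ _; rewrite /rip inner_linearl raddfD/= Re_realM. Qed.

Lemma sq_norm x : `|x| ^+ 2 = (sq x)%:C.
Proof.
by rewrite /sq /rip inner_norm RRe_real// rpredX// normr_real.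
Qed.

Lemma sq_ge0 x : 0 <= sq x.
Proof. by have : 0 <= `|x| ^+ 2 by []; rewrite sq_norm ler0c. Qed.

Lemma sq_eq0 x : sq x = 0 -> x = 0.
Proof.
by move=> x0; apply/eqP; rewrite -normr_eq0 -sqrf_eq0 sq_norm x0.
Qed.

Lemma rip_semi_inner P : real_semi_inner P rip.
Proof.
by split=> [z _|x y _ _|x _]; [exact: rip_linear|exact: ripC|exact: sq_ge0].
Qed.

Let subT : linear_subspace [set: V]. Proof. by split. Qed.
Let ripT := rip_semi_inner [set: V].

Lemma ripDl x y z : rip (x + y) z = rip x z + rip y z.
Proof. exact: (real_linearD (rip_linear (P := setT) z)). Qed.

Lemma ripBl x y z : rip (x - y) z = rip x z - rip y z.
Proof. exact: (real_linearB (rip_linear (P := setT) z)). Qed.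

Lemma ripZl (c : R) x z : rip (c%:C *: x) z = c * rip x z.
Proof. exact: (real_linearZ subT (rip_linear (P := setT) z)). Qed.

Lemma ripNl x z : rip (- x) z = - rip x z.
Proof. by have := ripZl (-1) x z; rewrite rmorphN1 scaleN1r mulN1r. Qed.

Lemma ripDr x y z : rip z (x + y) = rip z x + rip z y.
Proof. by rewrite ripC ripDl !(ripC z). Qed.

Lemma ripBr x y z : rip z (x - y) = rip z x - rip z y.
Proof. by rewrite ripC ripBl !(ripC z). Qed.

Lemma ripZr (c : R) x z : rip z (c%:C *: x) = c * rip z x.
Proof. by rewrite ripC ripZl (ripC z). Qed.

Lemma ripNr x z : rip z (- x) = - rip z x.
Proof. by rewrite ripC ripNl (ripC z). Qed.

Lemma rip0l z : rip 0 z = 0.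
Proof. exact: (real_linear0 subT (rip_linear (P := setT) z)). Qed.

Lemma rip_CauchySchwarz x y : rip x y ^+ 2 <= sq x * sq y.
Proof. exact: (form_CauchySchwarz subT ripT). Qed.

Lemma sqN x : sq (- x) = sq x.
Proof. by rewrite /sq ripNl ripNr opprK. Qed.

Lemma sqB x y : sq (x - y) = sq x - 2 * rip x y + sq y.
Proof. exact: (form_sqrB subT ripT). Qed.

Lemma sqD x y : sq (x + y) = sq x + 2 * rip x y + sq y.
Proof. exact: (form_sqrD subT ripT). Qed.

Lemma sqD_le x y : sq (x + y) <= 2 * sq x + 2 * sq y.
Proof. by have := sq_ge0 (x - y); rewrite sqB sqD; lra. Qed.

Lemma sqB_le x y : sq (x - y) <= 2 * sq x + 2 * sq y.
Proof. by rewrite -(sqN y); exact: sqD_le. Qed.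

Lemma sq_dist x y : sq (x - y) = sq (y - x).
Proof. by rewrite -sqN opprB. Qed.

Lemma sqZ (c : R) x : sq (c%:C *: x) = c ^+ 2 * sq x.
Proof. by rewrite /sq ripZl ripZr mulrA. Qed.

(** Expand [|t x - y|^2 >= 0], divide by [t], and use the result for both [y] and [- y]. *)
Lemma rip_young (t : R) x y : 0 < t -> 2 * `|rip x y| <= t * sq x + t^-1 * sq y.
Proof.
move=> t0.
have : forall y, 0 <= t * sq x - 2 * rip x y + t^-1 * sq y.
  move=> {}y; have := sq_ge0 (t%:C *: x - y).
  rewrite sqB sqZ ripZl => H.
  have -> : t * sq x - 2 * rip x y + t^-1 * sq y =
    t^-1 * (t ^+ 2 * sq x - 2 * (t * rip x y) + sq y) by field; rewrite gt_eqF.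
  by rewrite mulr_ge0// invr_ge0 ltW.
move=> H; have := H y; have := H (- y); rewrite ripNr sqN.
by case: (ler0P (rip x y)); lra.
Qed.

Lemma normr_lt_sq x (e : R) : 0 < e -> (`|x| < e%:C) = (sq x < e ^+ 2).
Proof.
move=> e0; rewrite -(ltr_pXn2r (n := 2)) ?nnegrE ?ler0c ?(ltW e0)//.
by rewrite sq_norm -rmorphXn/= ltcR.
Qed.

Lemma hilbert_cvgP (u : nat -> V) x :
  (u n @[n --> \oo] --> x) <-> vanishing rip u x.
Proof.
split=> [/cvgrPdist_lt ux e e0|ux].
  have /ux[N _ HN] : 0 < (Num.sqrt e)%:C :> R[i] by rewrite ltcR sqrtr_gt0.
  exists N => n /HN /=; rewrite normr_lt_sq ?sqrtr_gt0// sqr_sqrtr ?ltW//.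
  by rewrite -/(sq _) sq_dist.
apply/cvgrPdist_lt => e e0.
have er : e = (complex.Re e)%:C by rewrite RRe_real// gtr0_real.
have r0 : 0 < complex.Re e by rewrite -(ltcR 0) -er.
have [N HN] := ux _ (exprn_gt0 2 r0).
by exists N => // n /HN; rewrite er /= normr_lt_sq// sq_dist.
Qed.

Lemma hilbert_complete (u : nat -> V) : form_cauchy rip u ->
  exists x, vanishing rip u x.
Proof.
move=> uc; suff /cvg_ex[x /hilbert_cvgP] : cvgn u by exists x.
apply/cauchy_cvgP/cauchyP => e e0.
have er : e = (complex.Re e)%:C by rewrite RRe_real// gtr0_real.
have r0 : 0 < complex.Re e by rewrite -(ltcR 0) -er.
have [N HN] := uc _ (exprn_gt0 2 r0).
exists (u N); exists N => // n /= Nn.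
by rewrite -ball_normE/= er normr_lt_sq//; exact: HN.
Qed.

Lemma denseP P : dense P -> forall x (e : R), 0 < e -> exists2 y, P y & sq (x - y) < e.
Proof.
move=> dP x e e0.
have e'0 : 0 < (Num.sqrt e)%:C :> R[i] by rewrite ltcR sqrtr_gt0.
have [||y [By Py]] := dP (ball x (Num.sqrt e)%:C).
- by exists x; exact: ballxx.
- exact: ball_open.
by exists y => //; move: By; rewrite -ball_normE/= normr_lt_sq ?sqrtr_gt0// sqr_sqrtr// ltW.
Qed.

(** If [z] were non-zero, some [y] in [P] would satisfy [|z - y| < |z|]; but [<z - y, z> = |z|^2],
    against Cauchy-Schwarz. *)
Lemma orth_approx P z : (forall x (e : R), 0 < e -> exists2 y, P y & sq (x - y) < e) ->
  (forall x, P x -> rip x z = 0) -> z = 0.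
Proof.
move=> dP oz; apply: sq_eq0; apply/eqP; rewrite eq_le sq_ge0 andbT leNgt.
apply/negP => z0; have [y Py yz] := dP z _ z0.
have := rip_CauchySchwarz (z - y) z; rewrite ripBl (oz y Py) subr0 -/(sq z) expr2; nra.
Qed.

Lemma orth_dense P z : dense P -> (forall x, P x -> rip x z = 0) -> z = 0.
Proof. by move=> /denseP; exact: orth_approx. Qed.

(* Hence a linear or conjugate-linear functional is determined by its real part. *)
Lemma Re_rotate (p q : R[i]) : complex.Re p = complex.Re q ->
  complex.Re ('i * p) = complex.Re ('i * q) -> p = q.
Proof.
by case: p q => [p1 p2] [q1 q2] /= ->; rewrite !mul0r !mul1r !sub0r => /oppr_inj ->.
Qed.

End hilbert.

(** * Unbounded operators *)

Section operator_lemmas.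
Context (R : realType).
Implicit Types H K : hilbertType R.

Lemma closure_graphP H K (T : operator H K) x y :
  closure (op_graph T) (x, y) <->
  forall e : R, 0 < e -> exists x', [/\ dom T x', sq (x - x') < e & sq (y - T x') < e].
Proof.
split=> [Gxy e e0|Gxy B [[P Q] /= [/nbhs_ballP[p p0 pP] /nbhs_ballP[q q0 qQ]] PQB]].
  have r0 : 0 < Num.sqrt e by rewrite sqrtr_gt0.
  have r0' : 0 < (Num.sqrt e)%:C :> R[i] by rewrite ltcR.
  have [|[x' y'] [[/= Tx' <-] [/=]]] :=
      Gxy (ball x (Num.sqrt e)%:C `*` ball y (Num.sqrt e)%:C).
    exists (ball x (Num.sqrt e)%:C, ball y (Num.sqrt e)%:C) => //.
    by split; exact: nbhsx_ballx.
  rewrite -!ball_normE/= !normr_lt_sq// sqr_sqrtr ?ltW// => xx' yy'.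
  by exists x'.
have pr : p = (complex.Re p)%:C by rewrite RRe_real// gtr0_real.
have qr : q = (complex.Re q)%:C by rewrite RRe_real// gtr0_real.
have {}p0 : 0 < complex.Re p by rewrite -(ltcR 0) -pr.
have {}q0 : 0 < complex.Re q by rewrite -(ltcR 0) -qr.
rewrite pr in pP; rewrite qr in qQ.
have [|x' [Tx' xx' yx']] := Gxy (Num.min (complex.Re p ^+ 2) (complex.Re q ^+ 2)).
  by rewrite lt_min !exprn_gt0.
exists (x', T x'); split => //; apply: PQB; split => /=.
  apply: pP; rewrite -ball_normE/= normr_lt_sq//.
  by apply: lt_le_trans xx' _; rewrite ge_min lexx.
apply: qQ; rewrite -ball_normE/= normr_lt_sq//.
by apply: lt_le_trans yx' _; rewrite ge_min lexx orbT.
Qed.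

Lemma inner_orth_dense H (S : set H) z : dense S ->
  (forall x, S x -> inner x z = 0) -> z = 0.
Proof. by move=> dS oz; apply: (orth_dense dS) => x /oz; rewrite /rip => ->. Qed.

Lemma adjointP H K (T : operator H K) y : dom (adjoint T) y ->
  forall x, dom T x -> inner (T x) y = inner x (adjoint T y).
Proof. by move=> [z Tz]; have /= := xgetPex 0 (ex_intro _ z Tz). Qed.

Lemma adjoint_eq H K (T : operator H K) y z : densely_defined T ->
  (forall x, dom T x -> inner (T x) y = inner x z) ->
  dom (adjoint T) y /\ adjoint T y = z.
Proof.
move=> dT Tz; have dy : dom (adjoint T) y by exists z.
split=> //; apply/eqP; rewrite -subr_eq0; apply/eqP.
apply: (inner_orth_dense dT) => x Tx.
by rewrite innerBr -(adjointP dy Tx) -Tz// subrr.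
Qed.

Lemma adjoint_linear H K (T : operator H K) (c : R[i]) x y : densely_defined T ->
  dom (adjoint T) x -> dom (adjoint T) y ->
  adjoint T (c *: x + y) = c *: adjoint T x + adjoint T y.
Proof.
move=> dT Tx Ty; apply: (adjoint_eq dT _).2 => z Tz.
by rewrite !inner_linearr (adjointP Tx Tz) (adjointP Ty Tz).
Qed.

Lemma linear_op_subspace H K (T : operator H K) : linear_op T -> linear_subspace (dom T).
Proof. by move=> [T0 Tl]; split => // c x y Tx Ty; exact: (Tl c x y Tx Ty).1. Qed.

Lemma linear_op0 (H K : hilbertType R) (T : operator H K) : linear_op T -> T 0 = 0.
Proof.
move=> lT; have [_] := lT.2 1 0 0 lT.1 lT.1.
by rewrite !scale1r addr0 -[LHS]addr0 => /addrI.
Qed.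

Section self_adjoint.
Context H (T : operator H H).
Hypothesis saT : self_adjoint T.

Lemma self_adjoint_sym x y : dom T x -> dom T y -> inner (T x) y = inner x (T y).
Proof.
case: saT => _ _ [dT eqT] Tx Ty.
by rewrite -(eqT _ Ty); apply: adjointP => //; rewrite dT.
Qed.


(** Testing with [i x] as well as [x] recovers the imaginary part, so [y] lies in the domain of the
    adjoint, which is that of [T]. *)
Lemma self_adjoint_dom y z :
  (forall x, dom T x -> rip (T x) y = rip x z) -> dom T y /\ T y = z.
Proof.
case: saT => lT dT [dTs eqT] Tyz.
have [|dTy Tye] := @adjoint_eq _ _ T y z dT.
  move=> x Tx; apply: Re_rotate; first exact: Tyz.
  have [Tix Tixe] := lT.2 'i x 0 Tx lT.1.
  move: (Tyz _ Tix); rewrite Tixe (linear_op0 lT) !addr0 /rip !innerZl.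
  exact.
have Ty : dom T y by rewrite -dTs.
by split=> //; rewrite -eqT.
Qed.
End self_adjoint.
End operator_lemmas.

(** * Numerical range and the maximum of the spectrum *)

Section upper_bound.
Context (R : realType) (H : hilbertType R).

Lemma sq_le_norm (K : hilbertType R) (x : H) (y : K) (C : R) :
  `|x| <= C%:C * `|y| -> sq x <= C ^+ 2 * sq y.
Proof.
move=> xy; rewrite -lecR rmorphM/= rmorphXn/= -!sq_norm -exprMn.
by rewrite ler_pXn2r// nnegrE// (le_trans _ xy).
Qed.

Lemma Re_le (p q : R[i]) : p <= q -> complex.Re p <= complex.Re q.
Proof. by rewrite lecE => /andP[]. Qed.

Lemma Re_sq (c : R) (x : H) : complex.Re (c%:C * `|x| ^+ 2) = c * sq x.
Proof. by rewrite Re_realM sq_norm. Qed.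

(** The least upper bound [m] of the numerical range belongs to the spectrum, so [m <= d]. Indeed,
    if [m - D >= 0] had a bounded inverse, it would be bounded below by a positive constant and [m]
    could be lowered. *)
Lemma max_spectrum_bound (D : operator H H) (d : R) :
  (exists y : H, y != 0) -> self_adjoint D -> bounded_above D ->
  max_spectrum D d -> forall y, dom D y -> rip (D y) y <= d * sq y.
Proof.
move=> [y1 y1N0] saD [c0 Dc0] [_ maxd].
have [lD dD _] := saD; have subD := linear_op_subspace lD.
pose S := [set c : R | forall y, dom D y -> rip (D y) y <= c * sq y].
have Sc0 : S c0 by move=> y /Dc0 /Re_le; rewrite Re_sq.
(* A non-zero vector of the domain is what bounds [S] from below. *)
have [y0 Dy0 y00] : exists2 y0, dom D y0 & 0 < sq y0.
  have y1P : 0 < sq y1.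
    by rewrite lt_neqAle sq_ge0 andbT eq_sym; apply: contra_neq y1N0 => /sq_eq0.
  have [y0 Dy0 y01] := denseP dD y1 y1P; exists y0 => //.
  rewrite lt_neqAle sq_ge0 andbT; apply/eqP => /esym/sq_eq0 y00.
  by move: y01; rewrite y00 subr0 ltxx.
have hasinf : has_inf S.
  split; first by exists c0.
  exists (rip (D y0) y0 / sq y0) => c Sc.
  by rewrite ler_pdivrMr//; exact: Sc.
pose m := inf S.
have Sm : S m.
  move=> y Dy; rewrite -subr_le0; apply: (@le_eps _ _ (sq y)); first exact: sq_ge0.
  move=> e e0; have [c Sc cm] := inf_adherent e0 hasinf.
  have := Sc y Dy; have : c * sq y <= (m + e) * sq y by rewrite ler_wpM2r ?sq_ge0// ltW.
  lra.
suff specm : spectrum D m%:C.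
  have := maxd _ specm; rewrite lecR => md y Dy; apply: le_trans (Sm y Dy) _.
  by rewrite ler_wpM2r// sq_ge0.
move=> [surj [C bndC]].
pose g x y : R := m * rip x y - rip (D x) y.
have gP : real_semi_inner (dom D) g.
  split=> [z Dz c x y Dx Dy|x y Dx Dy|x Dx].
  - by rewrite /g (lD.2 _ _ _ Dx Dy).2 !ripDl !ripZl; ring.
  - by rewrite /g (ripC x) (ripC (D x)) [rip y (D x)]/rip -(self_adjoint_sym saD Dy Dx).
  - by rewrite /g subr_ge0; exact: Sm.
pose L := (1 + C ^+ 2) / 2.
have L0 : 0 < L by rewrite divr_gt0// ltr_wpDr// sqr_ge0.
(* Take [z] with [(m - D) z = y]. Then [g z y = |y|^2] and [g z z = <z, y> <= L |y|^2], so
   Cauchy-Schwarz for [g] gives the bound after cancelling [|y|^2]. *)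
have low y : dom D y -> sq y <= L * g y y.
  move=> Dy; have [z [[Dz zy] _]] := surj (- y).
  have Dz' : D z = m%:C *: z - y by rewrite -zy/= addrC subrK.
  have zz : g z z = rip z y by rewrite /g Dz' ripBl ripZl (ripC y); ring.
  have zy' : g z y = sq y by rewrite /g Dz' ripBl ripZl /sq; ring.
  have zC : sq z <= C ^+ 2 * sq y by have := sq_le_norm (bndC z Dz); rewrite zy sqN.
  have := form_CauchySchwarz subD gP Dz Dy; rewrite zy' zz.
  have rL : rip z y <= L * sq y.
    by have := sq_ge0 (z - y); rewrite sqB /L; lra.
  have := form_ge0 gP Dy; have := sq_ge0 y; set s := sq y; set G := g y y.
  move=> s0 G0 sG; have [->|sN0] := eqVneq s 0; first by rewrite mulr_ge0// ltW.
  have {sN0}s0 : 0 < s by rewrite lt_neqAle eq_sym sN0.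
  rewrite -(ler_pM2l s0) -expr2; apply: le_trans sG _.
  by rewrite mulrA (mulrC s) ler_wpM2r.
have : S (m - L^-1).
  move=> y Dy; have := low y Dy.
  rewrite -(ler_pM2l (x := L^-1)) ?invr_gt0// mulKf ?gt_eqF// /g -/(sq y); lra.
by move=> /(ge_inf hasinf.2); rewrite -/m lerDl oppr_ge0 invr_le0 leNgt L0.
Qed.

End upper_bound.

(** * The form of a semibounded operator *)

Section form_lemmas.
Context (R : realType) (H : hilbertType R).

Lemma normc_real (p : R[i]) : p = Num.conj p -> `|p| = `|complex.Re p|%:C.
Proof.
move=> pp; have pr : p \is Num.real by apply/CrealP; rewrite -pp.
by rewrite -{1}(RRe_real pr) normc_def/= expr0n addr0 sqrtr_sqr.
Qed.

(** Cauchy-Schwarz for the form of [A - c] makes [A] bounded on its dense domain, and a self-adjoint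
    operator is closed. This serves the case where the form of [A] is only given as semibounded from
    above. *)
Lemma two_sided_bound_full (A : operator H H) (c d : R) : self_adjoint A ->
  (forall x, dom A x -> c * sq x <= rip (A x) x) ->
  (forall x, dom A x -> rip (A x) x <= d * sq x) -> forall x, dom A x.
Proof.
move=> saA cA dA x.
have [lA dnA _] := saA; have subA := linear_op_subspace lA.
pose g x y : R := rip (A x) y - c * rip x y.
have gP : real_semi_inner (dom A) g.
  split=> [z Dz t u v Du Dv|u v Du Dv|u Du].
  - by rewrite /g (lA.2 _ _ _ Du Dv).2 !ripDl !ripZl; ring.
  - by rewrite /g (ripC u) (ripC (A u)) [rip v (A u)]/rip -(self_adjoint_sym saA Dv Du).
  - by rewrite /g subr_ge0; exact: cA.
pose L := d - c.
have bnd u v : dom A u -> dom A v -> g u v ^+ 2 <= (L * sq u) * (L * sq v).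
  move=> Du Dv; apply: le_trans (form_CauchySchwarz subA gP Du Dv) _.
  have gL w : dom A w -> 0 <= g w w <= L * sq w.
    by move=> Dw; rewrite (form_ge0 gP Dw) /g -/(sq w) /L; have := dA w Dw; lra.
  have /andP[u0 uL] := gL u Du; have /andP[v0 vL] := gL v Dv.
  exact: ler_pM.
(* For [v] in the domain close to [w = (A - c) u], the quantity [g u v = <w, v>] is close to
   [|w|^2], and [bnd] becomes [|w|^4 <= L^2 |u|^2 |w|^2] in the limit. *)
have bA u : dom A u -> sq (A u - c%:C *: u) <= L ^+ 2 * sq u.
  move=> Du; set w := A u - _.
  have [->|w0] := eqVneq (sq w) 0; first by rewrite mulr_ge0// ?sqr_ge0 ?sq_ge0.
  have {w0}w0 : 0 < sq w by rewrite lt_neqAle eq_sym w0 sq_ge0.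
  rewrite -subr_le0; apply: (@le_eps _ _ 8) => // e e0.
  (* The second entry keeps [|v|^2] comparable with [|w|^2]: [W <= 4 V] and [V <= 3 W]. *)
  pose e' := Num.min e (sq w / 4).
  have e'0 : 0 < e' by rewrite lt_min e0/= divr_gt0.
  have e'e : e' <= e by rewrite ge_min lexx.
  have e'w : e' <= sq w / 4 by rewrite ge_min lexx orbT.
  have [v Dv wv] := denseP dnA w e'0.
  have := bnd u v Du Dv; have -> : g u v = rip w v by rewrite /g /w ripBl ripZl.
  have := sqB w v; have := sqD_le (w - v) v; have := sqB_le w (w - v).
  rewrite subrK opprB addrC subrK.
  set W := sq w in w0 e'w *; set V := sq v; set d0 := sq (w - v) in wv *.
  set N := L ^+ 2 * sq u => V3 V4 pE pN.
  have d00 : 0 <= d0 by exact: sq_ge0.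
  rewrite leNgt; apply/negP => WN.
  have : (W + V - d0) ^+ 2 <= 4 * N * V.
    rewrite (_ : W + V - d0 = 2 * rip w v); last by lra.
    by rewrite /N /V; lra.
  have : 0 <= (W - V) ^+ 2 by exact: sqr_ge0.
  have VW : W <= 4 * V by lra.
  have V3W : V <= 3 * W by lra.
  have : 8 * e * W <= (W - N) * (4 * V).
    apply: le_trans (_ : (W - N) * W <= _); last by rewrite ler_wpM2l//; lra.
    by rewrite ler_wpM2r// ltW//; lra.
  have : d0 * (W + V) <= e * (4 * W).
    by apply: ler_pM => //; lra.
  have : 0 < e * W by rewrite mulr_gt0.
  rewrite !expr2; nra.
have w_lim n : exists v, dom A v /\ sq (x - v) < n.+1%:R^-1.
  have n0 : 0 < n.+1%:R^-1 :> R by [].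
  by have [v] := denseP dnA x n0; exists v.
have /choice[v vP] := w_lim.
pose w n := A (v n) - c%:C *: v n.
have AB y z : dom A y -> dom A z -> A (y - z) = A y - A z.
  move=> Dy Dz; have := (lA.2 (-1) z y Dz Dy).2.
  by rewrite !scaleN1r addrC => ->; rewrite addrC.
have [e e0|z wz] := @hilbert_complete _ _ w.
  have L1 : 0 < 1 + 4 * L ^+ 2 by rewrite ltr_wpDr// mulr_ge0// sqr_ge0.
  have [N HN] := harmonic_lt (divr_gt0 e0 L1).
  exists N => m n Nm Nn.
  have [Dm xm] := vP m; have [Dn xn] := vP n.
  have -> : w m - w n = A (v m - v n) - c%:C *: (v m - v n).
    by rewrite AB// scalerBr /w !opprD !opprK addrACA.
  apply: le_lt_trans (bA _ (subspaceB subA Dm Dn)) _.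
  have := sqB_le (x - v n) (x - v m); rewrite opprB addrC addrA subrK.
  have xm' := lt_trans xm (HN _ Nm); have xn' := lt_trans xn (HN _ Nn).
  set s := sq _; set r := e / _ in xm' xn' *.
  have er : e = (1 + 4 * L ^+ 2) * r by rewrite /r mulrC divfK// gt_eqF.
  have r0 : 0 < r by rewrite divr_gt0.
  move=> s4; rewrite er.
  have : L ^+ 2 * s <= L ^+ 2 * (4 * r) by rewrite ler_wpM2l ?sqr_ge0//; lra.
  by lra.
(* The limit [z] of [(A - c) v_n] should be [(A - c) x]; by self-adjointness it suffices to test
   this against [y] in the domain. *)
apply: (self_adjoint_dom saA (z := z + c%:C *: x) _).1 => y Dy.
apply/eqP; rewrite -subr_eq0 -sqrf_eq0 eq_le sqr_ge0 andbT.
apply: (@le_eps _ _ (2 * sq (A y - c%:C *: y) + 2 * sq y)).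
  by rewrite addr_ge0// mulr_ge0// sq_ge0.
move=> e e0; have [N1 H1] := harmonic_lt e0; have [N2 H2] := wz e e0.
pose n := maxn N1 N2; have [Dn xn] := vP n.
have {}xn : sq (x - v n) <= e by apply/ltW/(lt_trans xn)/H1; exact: leq_maxl.
have wn : sq (z - w n) <= e by rewrite sq_dist; apply/ltW/H2; exact: leq_maxr.
have := rip_CauchySchwarz (A y - c%:C *: y) (x - v n).
have := rip_CauchySchwarz y (z - w n).
have -> : rip (A y) x - rip y (z + c%:C *: x) =
    rip (A y - c%:C *: y) (x - v n) - rip y (z - w n).
  have : rip (A y) (v n) = rip y (A (v n)) by rewrite /rip (self_adjoint_sym saA).
  by rewrite /w !(ripBl, ripBr, ripDr, ripZl, ripZr) => ->; ring.
set p := rip _ (x - _); set q := rip y _; set P := sq (A y - _) => q2 p2.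
have := sqr_ge0 (p + q); have : P * sq (x - v n) <= P * e by rewrite ler_wpM2l// sq_ge0.
have : sq y * sq (z - w n) <= sq y * e by rewrite ler_wpM2l// sq_ge0.
lra.
Qed.

End form_lemmas.

Section form_operator.
Context (R : realType) (H : hilbertType R) (A : operator H H) (q : qform R H).
Hypotheses (saA : self_adjoint A) (bbA : bounded_below A) (qA : associated_form A q).

Lemma form_conj x : fdom q x -> q x x = Num.conj (q x x).
Proof. by case: qA => -[_ _ _ herm] _ _ _ _ qx; exact: herm. Qed.

Lemma form_subspace : linear_subspace (fdom q).
Proof. by case: qA => -[q0 ql _ _] _ _ _ _; split => // c x y; exact: ql. Qed.

Lemma dom_form x : dom A x -> fdom q x.
Proof. by case: qA => _ _ _ qAP _ Ax; have [] := (qAP x (A x)).1 (conj Ax erefl). Qed.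

Lemma dom_formE x y : dom A x -> fdom q y -> q x y = inner (A x) y.
Proof. by case: qA => _ _ _ qAP _ Ax; have [_] := (qAP x (A x)).1 (conj Ax erefl); exact. Qed.

(** If [q] is given as semibounded from above, then [A] is bounded on both sides, hence everywhere
    defined, and the lower bound of [A] is one for [q]. The shift [k = |c| + 1] makes the form
    dominate the squared norm. *)
Lemma form_lower : exists2 k : R, 0 <= k & forall x, fdom q x ->
  sq x <= k * sq x + complex.Re (q x x).
Proof.
have [c0 Ac0] := bbA.
have {}Ac0 x : dom A x -> c0 * sq x <= rip (A x) x.
  by move=> /Ac0 /Re_le; rewrite Re_sq.
have [c qc] : exists c : R, forall x, fdom q x -> c * sq x <= complex.Re (q x x).
  case: (qA) => _ [c [cq|qc]] _ _ _.
    by exists c => x /cq /Re_le; rewrite Re_sq.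
  exists c0 => x qx.
  suff Ax : dom A x by rewrite dom_formE//; exact: Ac0.
  apply: (two_sided_bound_full (c := c0) (d := c)) => // y Ay.
  by have := Re_le (qc _ (dom_form Ay)); rewrite Re_sq dom_formE//; exact: dom_form.
exists (`|c| + 1) => [|x qx]; first by rewrite addr_ge0.
have := qc x qx; have := sq_ge0 x; have := ler_norm (- c); rewrite normrN => nc x0.
have : - c * sq x <= `|c| * sq x by rewrite ler_wpM2r.
by lra.
Qed.

Section shifted.
Context (k : R).
Hypotheses (k0 : 0 <= k)
  (kP : forall x, fdom q x -> sq x <= k * sq x + complex.Re (q x x)).

Definition shifted_form x y : R := k * rip x y + complex.Re (q x y).
Local Notation h := shifted_form.

Lemma shifted_form_semi_inner : real_semi_inner (fdom q) h.
Proof.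
case: qA => -[q0 ql qlin herm] _ _ _ _.
split=> [z qz c x y qx qy|x y qx qy|x qx].
- by rewrite /h qlin// raddfD/= Re_realM ripDl ripZl; ring.
- by rewrite /h ripC herm//; case: (q y x).
- by apply: le_trans (kP qx); exact: sq_ge0.
Qed.

Lemma sq_le_shifted x : fdom q x -> sq x <= h x x. Proof. exact: kP. Qed.

(** Allows Cauchy sequences for the shifted form to be fed to [closed_form], which measures with
    [|q x x|]. *)
Lemma form_abs_le x : fdom q x -> `|q x x| <= ((1 + k) * h x x)%:C.
Proof.
move=> qx; rewrite normc_real; last exact: form_conj.
rewrite lecR; have := sq_le_shifted qx; have := sq_ge0 x.
have : k * sq x <= k * h x x by rewrite ler_wpM2l// sq_le_shifted.
have : 0 <= k * sq x by rewrite mulr_ge0// sq_ge0.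
by rewrite ler_norml /h -/(sq x); lra.
Qed.

(** The shifted form dominates the norm, so a Cauchy sequence has a limit in [H]; closedness puts it
    in the form domain and gives convergence of both summands. *)
Lemma shifted_form_complete : form_complete (fdom q) h.
Proof.
move=> u qu uc.
have qB m n : fdom q (u m - u n) by apply: (subspaceB form_subspace).
have [x ux] : exists x, vanishing (@rip R H) u x.
  apply: hilbert_complete => e /uc[N HN]; exists N => m n Nm Nn.
  by apply: le_lt_trans (sq_le_shifted (qB _ _)) (HN _ _ Nm Nn).
have k1 : 0 < 1 + k by rewrite ltr_pwDl.
case: (qA) => _ _ qcl _ _.
have [//||e e0|qx ux'] := qcl u x.
- exact/hilbert_cvgP.
- have [N HN] := uc _ (divr_gt0 e0 k1); exists N => m n Nm Nn.
  apply: le_lt_trans (form_abs_le (qB m n)) _; rewrite ltcR mulrC -ltr_pdivlMr//.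
  exact: HN.
exists x => // e e0; have e20 : 0 < e / 2 by rewrite divr_gt0.
have [N1 H1] := ux' _ e20; have [N2 H2] := ux _ (divr_gt0 e20 k1).
exists (maxn N1 N2) => n; rewrite geq_max => /andP[n1 n2].
have qn : fdom q (u n - x) by apply: (subspaceB form_subspace).
have := H1 n n1; rewrite normc_real; last exact: form_conj.
rewrite ltcR => qe; have := H2 n n2; rewrite ltr_pdivlMr// => se.
have := le_lt_trans (ler_norm _) qe; move: se; rewrite /h -/(sq _).
by have := sq_ge0 (u n - x); lra.
Qed.

Lemma shifted_form_dom x y : dom A x -> fdom q y ->
  h x y = rip (A x + k%:C *: x) y.
Proof. by move=> Ax qy; rewrite /h dom_formE// ripDl ripZl addrC. Qed.

(** Riesz in the form domain represents [<x, z>] as [h x u]; the first representation theorem then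
    places [u] in the domain of [A]. *)
Lemma shifted_surj z : exists2 x, dom A x & A x + k%:C *: x = z.
Proof.
have fl : real_linear (fdom q) (fun x => rip x z) by exact: rip_linear.
have [|u qu hu] := real_riesz form_subspace shifted_form_semi_inner
  (sq_ge0 z) shifted_form_complete fl.
  move=> x qx; apply: le_trans (rip_CauchySchwarz _ _) _.
  by rewrite mulrC ler_wpM2l ?sq_ge0// sq_le_shifted.
case: (qA) => -[_ ql qlin herm] _ _ qAP _.
have [Au Aue] : dom A u /\ A u = z - k%:C *: u.
  apply/qAP; split => // y qy; rewrite herm// [RHS]inner_conj; congr (Num.conj _).
  have qR x : fdom q x -> complex.Re (q x u) = complex.Re (inner x (z - k%:C *: u)).
    move=> qx; have := hu x qx; rewrite /h => hz.
    by rewrite -/(rip x _) ripBr ripZr hz; ring.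
  apply: Re_rotate; first exact: qR.
  have := qR _ (subspaceZ form_subspace 'i qy); rewrite innerZl.
  rewrite -[_ *: _]addr0 qlin//; last by case: form_subspace.
  have -> : q 0 u = 0.
    have := qlin 1 0 0 u form_subspace.1 form_subspace.1 qu.
    by rewrite scale1r addr0 mul1r -[LHS]addr0 => /addrI.
  by rewrite addr0.
by exists u => //; rewrite Aue subrK.
Qed.

End shifted.
End form_operator.

(** * Closures of operators, approximate eigenvalues and the resolvent set *)

Section closure_lemmas.
Context (R : realType).
Implicit Types H K : hilbertType R.

Lemma sqZC H (c : R[i]) (x : H) : sq (c *: x) = complex.Re (`|c| ^+ 2) * sq x.
Proof.
by rewrite mulrC -Re_realM mulrC -sq_norm -exprMn -normrZ sq_norm.
Qed.

Lemma Re_normX_ge0 (c : R[i]) : 0 <= complex.Re (`|c| ^+ 2).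
Proof. by have /Re_le : 0 <= `|c| ^+ 2 by []. Qed.

Lemma closure_graph_linear H K (T : operator H K) (c : R[i]) x y x' y' : linear_op T ->
  closure (op_graph T) (x, y) -> closure (op_graph T) (x', y') ->
  closure (op_graph T) (c *: x + x', c *: y + y').
Proof.
move=> lT /closure_graphP xy /closure_graphP xy'; apply/closure_graphP => e e0.
pose n := complex.Re (`|c| ^+ 2).
have n0 : 0 <= n := Re_normX_ge0 c.
have n1 : 0 < 2 * n + 2 by rewrite ltr_wpDl// mulr_ge0.
have d0 : 0 < e / (2 * n + 2) by rewrite divr_gt0.
have [u [Tu xu yu]] := xy _ d0; have [v [Tv xv yv]] := xy' _ d0.
have [Tuv Tuve] := lT.2 c _ _ Tu Tv.
have key (L : hilbertType R) (p p' q q' : L) : sq (p - q) < e / (2 * n + 2) ->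
    sq (p' - q') < e / (2 * n + 2) -> sq (c *: p + p' - (c *: q + q')) < e.
  move=> pq pq'; rewrite opprD addrACA -scalerBr.
  apply: le_lt_trans (sqD_le _ _) _; rewrite sqZC -/n.
  set d := e / _ in pq pq' d0; have ed : e = d * (2 * n + 2) by rewrite divfK// gt_eqF.
  have : n * sq (p - q) <= n * d by rewrite ler_wpM2l// ltW.
  rewrite ed; lra.
by exists (c *: u + v); rewrite Tuve; split => //; exact: key.
Qed.

Lemma closure_graph_closed H K (T : operator H K) x y :
  (forall e : R, 0 < e -> exists x' y',
    [/\ closure (op_graph T) (x', y'), sq (x - x') < e & sq (y - y') < e]) ->
  closure (op_graph T) (x, y).
Proof.
move=> xy; apply/closure_graphP => e e0.
have e40 : 0 < e / 4 by rewrite divr_gt0.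
have [x' [y' [/closure_graphP xy' xx' yy']]] := xy _ e40.
have [u [Tu xu yu]] := xy' _ e40; exists u.
have key (L : hilbertType R) (p q r : L) : sq (p - q) < e / 4 ->
    sq (q - r) < e / 4 -> sq (p - r) < e.
  move=> pq qr; rewrite -(subrK q p) -addrA.
  by apply: le_lt_trans (sqD_le _ _) _; lra.
by split => //; [exact: key xx' xu|exact: key yy' yu].
Qed.

Lemma op_closure_graph H K (T : operator H K) x : dom (op_closure T) x ->
  closure (op_graph T) (x, op_closure T x).
Proof. by move=> [y Ty]; have := xgetPex 0 (ex_intro _ y Ty). Qed.

Lemma op_shiftE H (T : operator H H) z x : op_shift T z x = T x - z *: x.
Proof. by []. Qed.

Section closable.
Context H (T : operator H H).
Hypotheses (lT : linear_op T) (cT : closable T).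

(** By closability the value picked by [xget] is the only possible one, since the closed graph is a
    subspace. *)
Lemma op_closure_eq x y : closure (op_graph T) (x, y) ->
  dom (op_closure T) x /\ op_closure T x = y.
Proof.
move=> Txy; have dx : dom (op_closure T) x by exists y.
split => //; apply/eqP; rewrite -subr_eq0; apply/eqP/cT.
have := closure_graph_linear (c := -1) lT Txy (op_closure_graph dx).
by rewrite !scaleN1r addrC subrr addrC.
Qed.

Lemma op_closure_linear : linear_op (op_closure T).
Proof.
split=> [|c x y Tx Ty].
  apply: (op_closure_eq (y := T 0) _).1; apply/closure_graphP => e e0.
  by exists 0; split; rewrite ?subrr ?/sq ?rip0l//; exact: lT.1.
by apply: op_closure_eq; apply: closure_graph_linear => //; exact: op_closure_graph.
Qed.

Lemma op_closure_extends x : dom T x -> dom (op_closure T) x /\ op_closure T x = T x.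
Proof.
move=> Tx; apply: op_closure_eq; apply/closure_graphP => e e0.
by exists x; split; rewrite ?subrr ?/sq ?rip0l.
Qed.

Variable z : R[i].
Local Notation M := (op_closure T).

Lemma op_shiftB x y : dom M x -> dom M y ->
  op_shift M z (x - y) = op_shift M z x - op_shift M z y.
Proof.
move=> Mx My; have := (op_closure_linear.2 (-1) y x My Mx).2.
rewrite !op_shiftE !scaleN1r ![- y + _]addrC [- M y + _]addrC => ->.
by rewrite scalerBr !opprD !opprK addrACA.
Qed.

(** If no constant [1 / (n + 1)] works, normalising the counterexamples [x n] by [c n = 1 / |x n|]
    yields a sequence of approximate eigenvectors. *)
Lemma not_app_spectrum_bound : ~ app_spectrum M z ->
  exists2 d : R, 0 < d & forall x, dom M x -> d * sq x <= sq (op_shift M z x).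
Proof.
move=> Nz; apply: contrapT => Nd; apply: Nz.
have /choice[x xP] n : exists x, dom M x /\ sq (op_shift M z x) < n.+1%:R^-1 * sq x.
  apply: contrapT => Nx; apply: Nd; exists n.+1%:R^-1 => // x Mx.
  by rewrite leNgt; apply/negP => xn; apply: Nx; exists x.
have x0 n : 0 < sq (x n).
  rewrite lt_neqAle sq_ge0 andbT; apply/eqP => xn0.
  by have := (xP n).2; rewrite -xn0 mulr0 ltNge sq_ge0.
pose c n := (Num.sqrt (sq (x n)))^-1.
have cE n : c n ^+ 2 * sq (x n) = 1.
  by rewrite exprVn sqr_sqrtr ?(ltW (x0 n))// mulVf// gt_eqF.
have scaled n : dom M ((c n)%:C *: x n) /\
    op_shift M z ((c n)%:C *: x n) = (c n)%:C *: op_shift M z (x n).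
  have [Mx _] := xP n; have M0 := op_closure_linear.1.
  have [] := op_closure_linear.2 (c n)%:C _ _ Mx M0.
  rewrite (linear_op0 op_closure_linear) !addr0 !op_shiftE => + ->.
  by rewrite scalerBr !scalerA (mulrC z).
exists (fun n => (c n)%:C *: x n); split=> [n|].
  split; first by case: (scaled n).
  apply/eqP; rewrite -(@eqrXn2 _ 2)//= expr1n sq_norm sqZ cE//.
apply/hilbert_cvgP => e /harmonic_lt[N HN]; exists N => n /HN.
rewrite subr0 (scaled n).2 -/(sq _) sqZ; apply: lt_trans.
rewrite [ltRHS](_ : _ = c n ^+ 2 * (n.+1%:R^-1 * sq (x n))); last by rewrite mulrCA cE mulr1.
by rewrite ltr_pM2l ?exprn_gt0 ?invr_gt0 ?sqrtr_gt0//; exact: (xP n).2.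
Qed.

(** The lower bound gives injectivity, a bounded inverse and closed range; the orthogonality
    hypothesis makes the range dense, hence everything. *)
Lemma not_app_spectrum_resolvent : ~ app_spectrum M z ->
  (forall v, (forall x, dom T x -> rip (op_shift T z x) v = 0) -> v = 0) ->
  resolvent_set M z.
Proof.
move=> /not_app_spectrum_bound[d d0 low] dense_range.
have inj x x' : dom M x -> dom M x' -> op_shift M z x = op_shift M z x' -> x = x'.
  move=> Mx Mx' xx'; apply/eqP; rewrite -subr_eq0; apply/eqP/sq_eq0/eqP.
  rewrite eq_le sq_ge0 andbT -(pmulr_rle0 _ d0).
  have Mxx' := subspaceB (linear_op_subspace op_closure_linear) Mx Mx'.
  by apply: le_trans (low _ Mxx') _; rewrite op_shiftB// xx' subrr /sq rip0l.
pose P := [set y | exists2 x, dom M x & op_shift M z x = y].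
have subP : linear_subspace P.
  split=> [|c _ _ [x Mx <-] [y My <-]].
    exists (0 - 0); last by rewrite op_shiftB ?subrr//; exact: op_closure_linear.1.
    by rewrite subrr; exact: op_closure_linear.1.
  have [Mxy Mxye] := op_closure_linear.2 c x y Mx My; exists (c *: x + y) => //.
  by rewrite !op_shiftE Mxye scalerDr scalerBr !scalerA (mulrC z) opprD addrACA.
(* Preimages of a Cauchy sequence in the range are Cauchy by the lower bound, and their limit is in
   the domain since the graph of [M] is closed. *)
have compP : form_complete P (@rip R H).
  move=> y Py yc; have [yl ylim] := hilbert_complete yc.
  have /choice[x xP] : forall n, exists x, dom M x /\ op_shift M z x = y n.
    by move=> n; have [x] := Py n; exists x.
  have [e e0|xl xlim] := @hilbert_complete _ _ x.
    have [N HN] := yc _ (mulr_gt0 d0 e0); exists N => m n Nm Nn.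
    have [Mm ym] := xP m; have [Mn yn] := xP n.
    rewrite -(ltr_pM2l d0); apply: le_lt_trans (HN _ _ Nm Nn).
    rewrite -ym -yn -op_shiftB//; apply: low.
    exact: (subspaceB (linear_op_subspace op_closure_linear) Mm Mn).
  have [Mxl Mxle] : dom M xl /\ M xl = yl + z *: xl.
    apply: op_closure_eq; apply: closure_graph_closed => e e0.
    have n1 : 0 < 2 + 2 * complex.Re (`|z| ^+ 2).
      by rewrite ltr_pwDl// mulr_ge0// Re_normX_ge0.
    have e1 : 0 < e / (2 + 2 * complex.Re (`|z| ^+ 2)) by rewrite divr_gt0.
    have [N1 H1] := xlim _ e0; have [N2 H2] := ylim _ e1; have [N3 H3] := xlim _ e1.
    pose n := maxn N1 (maxn N2 N3); have [Mn yn] := xP n.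
    exists (x n), (M (x n)); split; first exact: op_closure_graph.
      by rewrite sq_dist; apply: H1; exact: leq_maxl.
    have -> : yl + z *: xl - M (x n) = (yl - y n) + z *: (xl - x n).
      rewrite -yn op_shiftE scalerBr opprB [RHS]addrACA; congr (_ + _).
      by rewrite addrAC subrr add0r.
    apply: le_lt_trans (sqD_le _ _) _; rewrite sqZC (sq_dist yl) (sq_dist xl).
    have y2 := H2 n (leq_trans (leq_maxl _ _) (leq_maxr _ _)).
    have x3 := H3 n (leq_trans (leq_maxr _ _) (leq_maxr _ _)).
    set r := complex.Re _ in n1 e1 y2 x3 *; set d' := e / _ in e1 y2 x3.
    have r0 : 0 <= r by exact: Re_normX_ge0.
    have -> : e = d' * (2 + 2 * r) by rewrite divfK// gt_eqF.
    have : r * sq (x n - xl) <= r * d' by rewrite ler_wpM2l// ltW.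
    by move: y2; rewrite /sq; lra.
  by exists yl => //; exists xl => //; rewrite op_shiftE Mxle addrK.
(* Riesz on the complete subspace [P] produces the orthogonal projection [p] of [y], and [y - p] is
   orthogonal to the range. *)
have y_onto y : P y.
  have fl : real_linear P (fun x => rip x y) by exact: rip_linear.
  have [|p Pp pP] := real_riesz subP (rip_semi_inner P) (sq_ge0 y) compP fl.
    by move=> x _; rewrite mulrC; exact: rip_CauchySchwarz.
  suff /eqP : y - p = 0 by rewrite subr_eq0 => /eqP ->.
  apply: dense_range => x Tx; have [Mx Mxe] := op_closure_extends Tx.
  rewrite ripBr pP ?subrr//.
  by exists x => //; rewrite !op_shiftE Mxe.
split=> [y|].
  have [x Mx xy] := y_onto y; exists x; split => // x' [Mx' x'y].
  by apply: inj => //; rewrite xy.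
exists (Num.sqrt d^-1) => x Mx.
rewrite -(ler_pXn2r (n := 2)) ?nnegrE// ?mulr_ge0// ?ler0c ?sqrtr_ge0//.
rewrite exprMn !sq_norm -rmorphXn/= -rmorphM/= lecR sqr_sqrtr ?invr_ge0 ?(ltW d0)//.
by rewrite -(ler_pM2l d0) mulVKf ?gt_eqF//; exact: low.
Qed.

End closable.
End closure_lemmas.

(** * The block operator *)

Section block.
Context (R : realType) (H1 H2 : hilbertType R).
Local Notation W := (hsum H1 H2).

Lemma rip_hsum (v w : W) : rip v w = rip v.1 w.1 + rip v.2 w.2.
Proof. exact: raddfD. Qed.

Lemma sq_hsum (w : W) : sq w = sq w.1 + sq w.2.
Proof. exact: rip_hsum. Qed.

Lemma Re_indef_inner (w : W) : complex.Re (indef_inner w w) = sq w.1 - sq w.2.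
Proof. exact: raddfB. Qed.

(** Merges the two alternative assumptions on [B] and [D]; under the second one [y] itself serves as
    its approximation. *)
Lemma core_approx (B : operator H2 H1) (D : operator H2 H2) (qd : qform R H2) :
  associated_form D qd -> is_core (dom B) D \/ fdom qd `<=` dom B ->
  forall y (e : R), dom D y -> 0 < e ->
  exists y', [/\ dom B y', dom D y', sq (y - y') < e & sq (D y - D y') < e].
Proof.
move=> qD [[BD [domD eqD]]|qdB] y e Dy e0.
  have Cy : dom (op_closure (restriction D (dom B))) y by rewrite domD.
  have := op_closure_graph Cy; rewrite eqD// => /closure_graphP/(_ e e0).
  by move=> [y' [[Dy' By'] yy' yDy']]; exists y'.
by exists y; rewrite !subrr /sq rip0l; split => //; apply: qdB; exact: (dom_form qD).
Qed.

Context (A : operator H1 H1) (B : operator H2 H1) (D : operator H2 H2).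
Hypotheses (saA : self_adjoint A) (saD : self_adjoint D) (lB : linear_op B).
Hypotheses (dB : densely_defined B).
Hypothesis domAB : dom A `<=` dom (adjoint B).
Hypothesis core : forall y (e : R), dom D y -> 0 < e ->
  exists y', [/\ dom B y', dom D y', sq (y - y') < e & sq (D y - D y') < e].

Local Notation M0 := (block_op A B D).

Lemma block_op_linear : linear_op M0.
Proof.
case: saA => lA _ _; case: saD => lD _ _.
have Bs0 : dom (adjoint B) 0.
  by exists 0 => x _; rewrite -(subrr (0 : H1)) -(subrr (0 : H2)) !innerBr !subrr.
split=> [|c v w [[Av Bsv] [Bv Dv]] [[Aw Bsw] [Bw Dw]]].
  by split; split=> //=; [exact: lA.1|exact: lB.1|exact: lD.1].
have [A1 A2] := lA.2 c _ _ Av Aw; have [B1 B2] := lB.2 c _ _ Bv Bw.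
have [D1 D2] := lD.2 c _ _ Dv Dw.
split; first by split; split => //; exact: domAB.
have Bs := adjoint_linear c dB Bsv Bsw.
change ((A (c *: v.1 + w.1) + B (c *: v.2 + w.2),
  - adjoint B (c *: v.1 + w.1) + D (c *: v.2 + w.2)) =
  (c *: (A v.1 + B v.2) + (A w.1 + B w.2),
   c *: (- adjoint B v.1 + D v.2) + (- adjoint B w.1 + D w.2)) :> H1 * H2).
by rewrite A2 B2 D2 Bs !scalerDr scalerN opprD; congr pair; rewrite addrACA.
Qed.

Lemma adjoint_rip x y : dom (adjoint B) x -> dom B y ->
  rip (B y) x = rip (adjoint B x) y.
Proof. by move=> Bx By; rewrite ripC /rip [in LHS]inner_conj (adjointP Bx By) -inner_conj. Qed.

(* [w => (w.1, - w.2)] intertwines the indefinite and the definite inner product. *)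
Lemma block_op_sym (v w : W) : dom M0 v -> dom M0 w ->
  rip (M0 v).1 w.1 - rip (M0 v).2 w.2 = rip v.1 (M0 w).1 - rip v.2 (M0 w).2.
Proof.
move=> [[Av Bsv] [Bv Dv]] [[Aw Bsw] [Bw Dw]] /=.
rewrite !(ripDl, ripDr, ripNl, ripNr).
rewrite (adjoint_rip Bsw Bv) (ripC v.1 (B _)) (adjoint_rip Bsv Bw) (ripC v.2 (adjoint B _)).
have -> : rip (A v.1) w.1 = rip v.1 (A w.1) by rewrite /rip (self_adjoint_sym saA).
have -> : rip (D v.2) w.2 = rip v.2 (D w.2) by rewrite /rip (self_adjoint_sym saD).
ring.
Qed.

Lemma dom_block_op x y : dom A x -> dom B y -> dom D y -> dom M0 (x, y).
Proof. by move=> Ax By Dy; split; split => //; exact: domAB. Qed.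

(** By [block_op_sym], the limit [z] of [M0 v] as [v] tends to [0] is orthogonal to [dom M0] in the
    indefinite inner product. Vectors [(x, 0)] and [(0, y)] then detect its two components. *)
Lemma block_op_closable : closable M0.
Proof.
case: (saA) => lA dA _; case: (saD) => lD dD _.
move=> z /closure_graphP Gz.
have orth w : dom M0 w -> rip z.1 w.1 - rip z.2 w.2 = 0.
  move=> Mw; apply/eqP; rewrite -sqrf_eq0 eq_le sqr_ge0 andbT.
  pose J (u : W) : W := (u.1, - u.2).
  have ripJ u u' : rip u (J u') = rip u.1 u'.1 - rip u.2 u'.2.
    by rewrite rip_hsum ripNr.
  apply: (@le_eps _ _ (2 * sq (J w) + 2 * sq (J (M0 w)))).
    by rewrite addr_ge0// mulr_ge0// sq_ge0.
  move=> e e0; have [v [Mv]] := Gz e e0; rewrite sub0r sqN => v_e zv_e.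
  have := block_op_sym Mv Mw; rewrite -!ripJ => sym.
  have -> : rip z (J w) = rip (z - M0 v) (J w) + rip v (J (M0 w)).
    by rewrite ripBl sym subrK.
  have := rip_CauchySchwarz (z - M0 v) (J w).
  have := rip_CauchySchwarz v (J (M0 w)).
  set p := rip (z - _) _; set q := rip v _; set s := sq (J w); set t := sq (J _).
  have : sq (z - M0 v) * s <= e * s by rewrite ler_wpM2r ?sq_ge0// ltW.
  have : sq v * t <= e * t by rewrite ler_wpM2r ?sq_ge0// ltW.
  have := sqr_ge0 (p - q); lra.
have z1 : z.1 = 0.
  apply: (orth_dense dA) => x Ax; have := orth _ (dom_block_op Ax lB.1 lD.1).
  by rewrite /= (ripC z.2) rip0l subr0 ripC.
have z2 : z.2 = 0.
  (* Density of [dom B] intersected with [dom D] comes from approximating first in [dom D] and then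
     by [core]. *)
  apply: (@orth_approx _ _ (dom B `&` dom D)).
    move=> y e e0; have e40 : 0 < e / 4 by rewrite divr_gt0.
    have [y' Dy' yy'] := denseP dD y e40.
    have [y2 [By2 Dy2 y'y2 _]] := core Dy' e40.
    exists y2 => //; rewrite -(subrK y' y) -addrA.
    by apply: le_lt_trans (sqD_le _ _) _; lra.
  move=> y [By Dy]; have /= := orth _ (dom_block_op lA.1 By Dy).
  by rewrite z1 rip0l sub0r (ripC z.2) => /eqP; rewrite oppr_eq0 => /eqP.
by case: z z1 z2 {Gz orth} => z1 z2 /= -> ->.
Qed.

End block.

(** * Vectors orthogonal to the range of the shifted block operator *)

Section orthogonal_range.
Context (R : realType) (H1 H2 : hilbertType R).
Local Notation W := (hsum H1 H2).
Context (A : operator H1 H1) (B : operator H2 H1) (D : operator H2 H2)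
  (qa : qform R H1) (a b : R).
Hypotheses (saA : self_adjoint A) (bbA : bounded_below A) (qA : associated_form A qa).
Hypotheses (saD : self_adjoint D) (lB : linear_op B) (dB : densely_defined B).
Hypothesis qB : fdom qa `<=` dom (adjoint B).
Hypothesis core : forall y (e : R), dom D y -> 0 < e ->
  exists y', [/\ dom B y', dom D y', sq (y - y') < e & sq (D y - D y') < e].
Hypotheses (b0 : 0 <= b)
  (Bab : forall x, fdom qa x -> sq (adjoint B x) <= a * sq x + b * complex.Re (qa x x)).

Local Notation M0 := (block_op A B D).

Lemma adjoint0 : adjoint B 0 = 0.
Proof.
apply: (adjoint_eq dB _).2 => x _.
by rewrite -(subrr (0 : H1)) -(subrr (0 : H2)) !innerBr !subrr.
Qed.

Lemma adjointB x y : dom (adjoint B) x -> dom (adjoint B) y ->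
  adjoint B (x - y) = adjoint B x - adjoint B y.
Proof.
move=> Bx By; have := adjoint_linear (-1) dB By Bx.
by rewrite !scaleN1r addrC => ->; rewrite addrC.
Qed.

Lemma rip_block_shift (l : R) x y (v : W) :
  rip (op_shift M0 l%:C (x, y)) v =
  (rip (A x) v.1 + rip (B y) v.1 - l * rip x v.1) +
  (- rip (adjoint B x) v.2 + rip (D y) v.2 - l * rip y v.2).
Proof.
rewrite rip_hsum; change (rip (A x + B y - l%:C *: x) v.1 +
  rip (- adjoint B x + D y - l%:C *: y) v.2 = 
  (rip (A x) v.1 + rip (B y) v.1 - l * rip x v.1) +
  (- rip (adjoint B x) v.2 + rip (D y) v.2 - l * rip y v.2)).
by rewrite !ripBl !ripDl ripNl !ripZl.
Qed.

(** The sign change in the second component reflects the symmetry of [M0] for the indefinite inner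
    product. The kernel equation is only obtained in the closure, because [v.2] need not lie in
    [dom B]. *)
Lemma block_orth_kernel (l : R) (v : W) :
  (forall w, dom M0 w -> rip (op_shift M0 l%:C w) v = 0) ->
  closure (op_graph M0) ((v.1, - v.2) : W, l%:C *: ((v.1, - v.2) : W)).
Proof.
move=> orth; have [k k0 kP] := form_lower saA bbA qA.
have lA : linear_op A by case: saA.
have lD : linear_op D by case: saD.
have domAB : dom A `<=` dom (adjoint B) by move=> x Ax; apply/qB/(dom_form qA).
pose h := shifted_form qa k.
have subq := form_subspace qA.
have hP : real_semi_inner (fdom qa) h := shifted_form_semi_inner qA kP.
have sqh x : fdom qa x -> sq x <= h x x := sq_le_shifted kP (x := x).
pose K := `|a| + b + 1.
have K1 : 1 <= K by rewrite lerDr addr_ge0.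
have Bh x : fdom qa x -> sq (adjoint B x) <= K * h x x.
  move=> qx; apply: le_trans (Bab qx) _.
  have := sqh x qx; have := sq_ge0 x; have := ler_norm a.
  have : 0 <= k * sq x by rewrite mulr_ge0// sq_ge0.
  have -> : complex.Re (qa x x) = h x x - k * sq x by rewrite /h /shifted_form -/(sq x); ring.
  move=> ks na x0 xh.
  have : a * sq x <= `|a| * sq x by rewrite ler_wpM2r.
  have : `|a| * sq x <= `|a| * h x x by rewrite ler_wpM2l.
  have : 0 <= b * (k * sq x) by rewrite mulr_ge0.
  rewrite /K; lra.
have orthA x : dom A x -> rip (A x) v.1 - l * rip x v.1 = rip (adjoint B x) v.2.
  move=> Ax; have := orth _ (dom_block_op domAB Ax lB.1 lD.1).
  rewrite rip_block_shift (linear_op0 lB) (linear_op0 lD) !rip0l; lra.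
have orthD y : dom B y -> dom D y ->
    rip (B y) v.1 + rip (D y) v.2 - l * rip y v.2 = 0.
  move=> By Dy; have := orth _ (dom_block_op domAB lA.1 By Dy).
  rewrite rip_block_shift (linear_op0 lA) adjoint0 !rip0l; lra.
(* By [orthA] this equals [<(A + k) x, v.1>] on [dom A], but it is defined and bounded on the whole
   form domain. *)
pose f x := rip (adjoint B x) v.2 + (l + k) * rip x v.1.
have fl : real_linear (fdom qa) f.
  move=> c x y qx qy; rewrite /f adjoint_linear ?ripDl ?ripZl//; try exact: qB.
  by ring.
pose C := 2 * K * sq v.2 + 2 * (l + k) ^+ 2 * sq v.1.
have C0 : 0 <= C.
  by rewrite addr_ge0// mulr_ge0 ?sq_ge0// mulr_ge0 ?sqr_ge0// (le_trans _ K1).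
have fC x : fdom qa x -> f x ^+ 2 <= C * h x x.
  move=> qx; have := rip_CauchySchwarz (adjoint B x) v.2.
  have := rip_CauchySchwarz x v.1; rewrite /f /C.
  set p := rip _ v.2; set q := rip x _ => q2 p2.
  have : sq (adjoint B x) * sq v.2 <= K * h x x * sq v.2.
    by rewrite ler_wpM2r ?sq_ge0// Bh.
  have : sq x * sq v.1 <= h x x * sq v.1 by rewrite ler_wpM2r ?sq_ge0// sqh.
  have := sqr_ge0 (p - (l + k) * q); have := sqr_ge0 (l + k).
  move=> lk0 pq xh Bxh.
  have : (l + k) ^+ 2 * q ^+ 2 <= (l + k) ^+ 2 * (h x x * sq v.1).
    by rewrite ler_wpM2l// (le_trans q2).
  lra.
have [u' qu' fu'] := real_riesz subq hP C0 (shifted_form_complete qA k0 kP) fl fC.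
(* Both vectors represent [f] on [dom A], so their difference is orthogonal to the range of [A + k],
   which is the whole space. Thus [v.1] is in the form domain. *)
have uu' : v.1 - u' = 0.
  have [x Ax xu] := shifted_surj qA k0 kP (v.1 - u').
  apply: sq_eq0; rewrite /sq -{1}xu ripBr -(shifted_form_dom qA k Ax qu').
  have := fu' x (dom_form qA Ax); rewrite /h => <-.
  by rewrite /f -orthA// ripDl ripZl; ring.
move/eqP: uu'; rewrite subr_eq0 => /eqP uu'.
rewrite -uu' in qu' fu'; clear u' uu'; set u := v.1 in qu' fu' *.
pose Bu := adjoint B u.
(* By [orthD] the tested identity holds on [dom B] intersected with [dom D]; [core] carries it to
   [dom D], and self-adjointness concludes. *)
have [Dv Dve] : dom D v.2 /\ D v.2 = l%:C *: v.2 - Bu.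
  apply: self_adjoint_dom => // y Dy.
  apply/eqP; rewrite -subr_eq0 -sqrf_eq0 eq_le sqr_ge0 andbT.
  set c := _ - Bu.
  apply: (@le_eps _ _ (2 * sq v.2 + 2 * sq c)); first by rewrite addr_ge0// mulr_ge0// sq_ge0.
  move=> e e0; have [y' [By' Dy' yy' yDy']] := core Dy e0.
  have := orthD y' By' Dy'; rewrite (adjoint_rip (qB qu') By') -/Bu => y'0.
  have -> : rip (D y) v.2 - rip y c = rip (D y - D y') v.2 - rip (y - y') c.
    have cE : rip y' c = l * rip y' v.2 - rip Bu y' by rewrite /c ripBr ripZr (ripC y' Bu).
    by rewrite !ripBl; lra.
  have := rip_CauchySchwarz (D y - D y') v.2; have := rip_CauchySchwarz (y - y') c.
  set p := rip _ v.2; set q := rip _ c => q2 p2; have := sqr_ge0 (p + q).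
  have : sq (D y - D y') * sq v.2 <= e * sq v.2 by rewrite ler_wpM2r ?sq_ge0// ltW.
  have : sq (y - y') * sq c <= e * sq c by rewrite ler_wpM2r ?sq_ge0// ltW.
  lra.
set y := - v.2.
have [Dy Dye] : dom D y /\ D y = Bu + l%:C *: y.
  have [] := lD.2 (-1) v.2 0 Dv lD.1.
  rewrite (linear_op0 lD) !addr0 !scaleN1r => ? ->; split => //.
  by rewrite Dve opprB scalerN.
apply/closure_graphP => e e0.
(* Sum of the coefficients of [d] in the final estimates: [K + 1] for the distance of the arguments,
   the next two terms for the rows of the residual, and [1] for strictness. *)
pose N := K + 1 + k ^+ 2 * K + (2 + 2 * K ^+ 2) + 1.
have K0 : 0 <= K by lra.
have kK0 : 0 <= k ^+ 2 * K by rewrite mulr_ge0// sqr_ge0.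
have KK0 : 0 <= K ^+ 2 by rewrite sqr_ge0.
have N0 : 0 < N by rewrite /N; lra.
have d0 : 0 < e / N by rewrite divr_gt0.
set d := e / N in d0; have eN : e = d * N by rewrite divfK// gt_eqF.
have [y' [By' Dy' yy' yDy']] := core Dy d0.
(* This choice of [x'] reduces the residual of the first row to [k (x' - u)]. *)
have [x' Ax' x'E] := shifted_surj qA k0 kP (- B y' + (l + k)%:C *: u).
have qx' := dom_form qA Ax'.
pose xi := x' - u; have qxi : fdom qa xi := subspaceB subq qx' qu'.
(* The right-hand side for [x'] and the functional [f] representing [u] differ only in [y'] against
   [y]; hence [h xi xi] is of the order of [|y - y'|^2]. *)
have hxi : h xi xi = rip (adjoint B xi) (y - y').
  have -> : h xi xi = h xi x' - h xi u.
    exact: (real_linearB (form_linr subq hP qxi) qx' qu').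
  rewrite (form_sym hP qxi qx') -fu'// {1}/h (shifted_form_dom qA k Ax' qxi) x'E.
  rewrite ripDl ripNl ripZl (adjoint_rip (qB qxi) By') /f (ripC u).
  have -> : rip (adjoint B xi) (y - y') = - rip (adjoint B xi) v.2 - rip (adjoint B xi) y'.
    by rewrite ripBr ripNr.
  ring.
have hd : h xi xi <= K * d.
  have h0 := form_ge0 hP qxi.
  have : h xi xi ^+ 2 <= h xi xi * (K * d).
    rewrite {1}hxi; apply: le_trans (rip_CauchySchwarz _ _) _.
    rewrite mulrCA mulrA; apply: ler_pM; rewrite ?sq_ge0//; first exact: Bh.
    exact: ltW.
  rewrite expr2; have [->|hN0] := eqVneq (h xi xi) 0; first by rewrite mulr_ge0// ltW.
  by rewrite ler_pM2l// lt_neqAle eq_sym hN0.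
have xd : sq xi <= K * d by apply: le_trans hd; exact: sqh.
have Bd : sq (adjoint B xi) <= K ^+ 2 * d.
  by apply: le_trans (Bh _ qxi) _; rewrite expr2 -mulrA ler_wpM2l.
have kKd : k ^+ 2 * sq xi <= k ^+ 2 * K * d by rewrite -mulrA ler_wpM2l// sqr_ge0.
have kKd0 : 0 <= k ^+ 2 * K * d by rewrite mulr_ge0// ltW.
have Kd0 : 0 <= K * d by rewrite mulr_ge0// ltW.
have KKd0 : 0 <= K ^+ 2 * d by rewrite mulr_ge0// ltW.
exists ((x', y') : W); split; first exact: dom_block_op.
  rewrite sq_hsum /= sq_dist -/xi eN /N; lra.
rewrite sq_hsum; change (sq (l%:C *: u - (A x' + B y')) +
  sq (l%:C *: y - (- adjoint B x' + D y')) < e).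
have -> : l%:C *: u - (A x' + B y') = k%:C *: xi.
  have -> : A x' = - B y' + (l + k)%:C *: u - k%:C *: x' by rewrite -x'E addrK.
  rewrite /xi rmorphD/= scalerBr scalerDl.
  by rewrite [_ - _ + B y']addrC -[- _ + _ - _]addrA addNKr opprB addrCA opprD addNKr.
have -> : l%:C *: y - (- adjoint B x' + D y') = adjoint B xi + (D y - D y').
  rewrite (adjointB (qB qx') (qB qu')) Dye -/Bu.
  by rewrite -(addrA Bu) (addrA _ Bu) subrK opprD opprK addrCA.
have := sqD_le (adjoint B xi) (D y - D y'); rewrite sqZ eN /N; lra.
Qed.

End orthogonal_range.

(** * The quantitative positivity estimate and its extension to the closure *)

Section positivity.
Context (R : realType).

Lemma limn_einf_ge (u : nat -> \bar R) (c : \bar R) N :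
  (forall n, (N <= n)%N -> (c <= u n)%E) -> (c <= limn_einf u)%E.
Proof.
move=> uc; rewrite limn_einf_lim; apply: lime_ge; first exact: is_cvg_einfs.
exists N => // n /= Nn; apply: le_ereal_inf_tmp => _ [m /= nm <-].
by apply: uc; exact: leq_trans nm.
Qed.

(** Young's inequality with weight [t]: closeness [t^2] compensates the factor [t^-1], and closeness
    [t] handles the remaining square. *)
Lemma sq_perturb (H : hilbertType R) (x x' : H) (t : R) : 0 < t ->
  sq (x - x') < Num.min t (t ^+ 2) -> `|sq x - sq x'| <= t * (sq x + 2).
Proof.
move=> t0; rewrite lt_min => /andP[dt dt2].
have := rip_young x (x - x') t0; have := sqB x (x - x').
rewrite opprB addrC subrK.
have : t^-1 * sq (x - x') <= t by rewrite ler_pdivrMl// -expr2 ltW.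
move=> td -> xy; rewrite ler_norml.
have := ler_norm (rip x (x - x')); have := ler_norm (- rip x (x - x')); rewrite normrN.
have := sq_ge0 x; have := sq_ge0 (x - x'); lra.
Qed.

(* [X], [Y] are the squared norms of the components, [s = <(l - D) y, y>],
   [T] the squared norm of [(l - D) y], and [r] the error terms. *)
Lemma quadratic_positivity (b k c C X Y s T r : R) (eta : R) :
  0 <= b -> 0 < k -> 0 < eta -> 2 * eta <= 1 -> b <= k -> 0 <= X -> 
  k * Y <= s -> 2 * k * s <= T + k ^+ 2 * Y ->
  (1 - eta) * T - b * s <= c * X + b * eta * (X + Y) + C * r ->
  ((1 - eta) * k ^+ 2 - b * k - b * eta) * Y <= (Num.max c 0 + b * eta) * X + C * r.
Proof.
move=> b0 k0 eta0 eta1 bk X0 kY Ts H.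
have : (1 - eta) * (2 * k * s) <= (1 - eta) * (T + k ^+ 2 * Y).
  by rewrite ler_wpM2l//; lra.
(* The coefficient is nonnegative because [2 k (1 - eta) >= k >= b]. *)
have : (2 * k * (1 - eta) - b) * (k * Y) <= (2 * k * (1 - eta) - b) * s.
  rewrite ler_wpM2l//; have : k * (2 * eta) <= k * 1 by rewrite ler_wpM2l// ltW.
  lra.
have : c * X <= Num.max c 0 * X by rewrite ler_wpM2r// le_max lexx.
rewrite !expr2; lra.
Qed.

Context (H1 H2 : hilbertType R).
Local Notation W := (hsum H1 H2).
Context (A : operator H1 H1) (B : operator H2 H1) (D : operator H2 H2)
  (qa : qform R H1) (a b d : R).
Hypothesis qA : associated_form A qa.
Hypotheses (b0 : 0 <= b)
  (Bab : forall x, fdom qa x -> sq (adjoint B x) <= a * sq x + b * complex.Re (qa x x))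
  (Dd : forall y, dom D y -> rip (D y) y <= d * sq y).
Local Notation M0 := (block_op A B D).

(** A single inequality with fixed constants, instead of a statement on sequences, passes to the
    closure and yields the lower limit at once. *)
Lemma block_positivity (l : R) :
  d + b + Num.sqrt (Num.max (b * d + b ^+ 2 + a) 0) < l ->
  exists p q r : R, [/\ 0 < p, 0 < q, 0 <= r &
    forall w, dom M0 w ->
      p * sq w <= q * (sq w.1 - sq w.2) + r * sq (op_shift M0 l%:C w)].
Proof.
move=> mul; have b_ge0 := b0; pose k := l - d.
set sr := Num.sqrt _ in mul.
have sr0 : 0 <= sr by exact: sqrtr_ge0.
have bk : b < k by rewrite /k; lra.
have k0 : 0 < k := le_lt_trans b0 bk.
have srk : sr < k - b by rewrite /k; lra.
have kb2 : b * d + b ^+ 2 + a < (k - b) ^+ 2.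
  apply: (@le_lt_trans _ _ (sr ^+ 2)); last by rewrite ltr_pXn2r ?nnegrE//; lra.
  by rewrite sqr_sqrtr ?le_max ?lexx// orbT.
pose c := a + b * l; pose m := Num.max c 0.
have m0 : 0 <= m by rewrite le_max lexx orbT.
(* With [l = k + d], the bound [a + b l < k^2 - b k] is [kb2] rearranged; the bound for [0] is
   [k (k - b) > 0]. *)
have c1m : m < k ^+ 2 - b * k.
  rewrite /m gt_max; apply/andP; split; last first.
    by rewrite expr2 -mulrBl mulr_gt0//; lra.
  by rewrite /c; move: kb2; rewrite (_ : l = k + d) /k; [lra|ring].
(* Young's weight [eta] is chosen to spend half of the gap [k^2 - b k - m]: then [p - q] is the
   other half. *)
pose N := 2 * (k ^+ 2 + 2 * b).
have N0 : 0 < N by rewrite mulr_gt0// ltr_wpDr ?exprn_gt0// mulr_ge0.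
pose eta := (k ^+ 2 - b * k - m) / N.
have etaN : eta * N = k ^+ 2 - b * k - m by rewrite divfK// gt_eqF.
have eta0 : 0 < eta by rewrite divr_gt0// subr_gt0.
have bk0 : 0 <= b * k by rewrite mulr_ge0// ltW.
have eta1 : 2 * eta <= 1.
  rewrite /eta mulrA ler_pdivrMr// mul1r /N; lra.
pose p := (1 - eta) * k ^+ 2 - b * k - b * eta; pose q := m + b * eta.
have q0 : 0 <= q by rewrite addr_ge0// mulr_ge0// ltW.
have qp : q < p by move: etaN; rewrite /q /p /N; lra.
pose C := (b + 1) / eta.
have C0 : 0 <= C by rewrite divr_ge0 ?ltW//; lra.
(* Twice the inequality [p Y <= q X + C r], rewritten in terms of [X + Y] and [X - Y]. *)
exists (p - q), (p + q), (2 * C); split; [lra|lra|by rewrite mulr_ge0|].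
move=> [x y] [[/= Ax Bx] [By Dy]].
have qx := dom_form qA Ax.
pose f := A x + B y - l%:C *: x; pose g := - adjoint B x + D y - l%:C *: y.
pose z := l%:C *: y - D y.
rewrite !sq_hsum; change (op_shift M0 l%:C (x, y)) with ((f, g) : W) => /=.
have [X0 Y0 f0 g0] : [/\ 0 <= sq x, 0 <= sq y, 0 <= sq f & 0 <= sq g].
  by split; exact: sq_ge0.
have sE : rip z y = l * sq y - rip (D y) y by rewrite /z ripBl ripZl.
have kY : k * sq y <= rip z y by rewrite sE /k; have := Dd Dy; lra.
have Tk : 2 * k * rip z y <= sq z + k ^+ 2 * sq y.
  by have := sq_ge0 (z - k%:C *: y); rewrite sqB sqZ ripZr; lra.
(* Sum of the first row tested with [x] and the second with [y]: the terms in [B] combine to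
   [<z, y>] and the errors. *)
have ax : complex.Re (qa x x) = l * sq x + rip z y + rip f x + rip g y.
  rewrite (dom_formE qA Ax qx) -/(rip _ _) sE /f /g !(ripBl, ripDl, ripNl, ripZl).
  by rewrite (adjoint_rip Bx By) /sq; ring.
(* The second row reads [B^* x = - (z + g)]. *)
have Bxe : sq (adjoint B x) = sq z + 2 * rip z g + sq g.
  rewrite -sqD -sqN; congr (sq _).
  by rewrite /z /g addrC -addrA [- (l%:C *: y) + _]addrA addNr add0r addrK.
have yf := rip_young x f eta0; have yg := rip_young y g eta0.
have zg := rip_young z g eta0.
have nf := ler_norm (rip x f); have ng := ler_norm (rip y g).
have nz := ler_norm (- rip z g); rewrite normrN in nz.
have bf : b * rip f x <= b * (eta * sq x + eta^-1 * sq f).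
  by rewrite ler_wpM2l// ripC; have := normr_ge0 (rip x f); lra.
have bg : b * rip g y <= b * (eta * sq y + eta^-1 * sq g).
  by rewrite ler_wpM2l// ripC; have := normr_ge0 (rip y g); lra.
have key : (1 - eta) * sq z - b * rip z y <=
    c * sq x + b * eta * (sq x + sq y) + C * (sq f + sq g).
  have := Bab qx; rewrite Bxe ax /c /C.
  have : 0 <= eta^-1 * sq f by rewrite mulr_ge0// invr_ge0 ltW.
  lra.
have pq : p * sq y <= q * sq x + C * (sq f + sq g).
  exact: (quadratic_positivity b0 k0 eta0 eta1 (ltW bk) X0 kY Tk key).
by clearbody p q C; lra.
Qed.

End positivity.

(** Every term is continuous in the graph norm: an approximation in [dom T] changes each by at most
    [t] times a constant depending only on [w] and [z]. *)
Lemma closure_positivity (R : realType) (H1 H2 : hilbertType R)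
    (T : operator (hsum H1 H2) (hsum H1 H2)) (l p q r : R) :
  0 <= p -> 0 <= q -> 0 <= r ->
  (forall w, dom T w ->
    p * sq w <= q * (sq w.1 - sq w.2) + r * sq (op_shift T l%:C w)) ->
  forall w z, closure (op_graph T) (w, z) ->
    p * sq w <= q * (sq w.1 - sq w.2) + r * sq (z - l%:C *: w).
Proof.
move=> p0 q0 r0 pT w z /closure_graphP Twz; rewrite -subr_le0.
set s := z - _.
apply: (@le_eps _ _ (p * (sq w + 2) + q * ((sq w.1 + 2) + (sq w.2 + 2)) + r * (sq s + 2))).
  by rewrite !addr_ge0// mulr_ge0// ?addr_ge0// ?sq_ge0.
move=> t t0.
have m0 : 0 < Num.min t (t ^+ 2) by rewrite lt_min t0 exprn_gt0.
set m := Num.min _ _ in m0.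
(* From [|p - l q|^2 <= 2 |p|^2 + 2 l^2 |q|^2], so that closeness [m / n] in the graph leaves the
   shifted values within [m]. *)
pose n := 2 + 2 * l ^+ 2.
have n1 : 2 <= n by rewrite lerDl mulr_ge0// sqr_ge0.
have n0 : 0 < n by lra.
have [w' [Tw' ww']] := Twz _ (divr_gt0 m0 n0); set e := m / n => zw'.
have me : m = e * n by rewrite divfK// gt_eqF.
have e0 : 0 < e by rewrite divr_gt0.
have em : e < m by rewrite me; nra.
have W := sq_perturb t0 (lt_trans ww' em).
have := ww'; rewrite sq_hsum => w12.
have W1 : `|sq w.1 - sq w'.1| <= t * (sq w.1 + 2).
  apply: sq_perturb => //; apply: le_lt_trans (lt_trans w12 em).
  by rewrite lerDl sq_ge0.
have W2 : `|sq w.2 - sq w'.2| <= t * (sq w.2 + 2).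
  apply: sq_perturb => //; apply: le_lt_trans (lt_trans w12 em).
  by rewrite lerDr sq_ge0.
have S : `|sq s - sq (op_shift T l%:C w')| <= t * (sq s + 2).
  apply: sq_perturb => //; rewrite op_shiftE /s.
  have -> : z - l%:C *: w - (T w' - l%:C *: w') = (z - T w') - l%:C *: (w - w').
    by rewrite scalerBr !opprD !opprK addrACA.
  apply: le_lt_trans (sqB_le _ _) _; rewrite sqZ -/m me /n.
  have : l ^+ 2 * sq (w - w') <= l ^+ 2 * e by rewrite ler_wpM2l ?sqr_ge0// ltW.
  lra.
have := pT w' Tw'.
move: W W1 W2 S; rewrite !ler_norml => /andP[Wa Wb] /andP[W1a W1b] /andP[W2a W2b] /andP[Sa Sb].
have P := ler_wpM2l p0 Wb.
have Q1 := ler_wpM2l q0 W1a; have Q2 := ler_wpM2l q0 W2b; have Rr := ler_wpM2l r0 Sa.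
lra.
Qed.

(** * Positive type of the spectral points beyond the bound *)

Theorem theorem7p1 (R : realType) (H1 H2 : hilbertType R)
    (A : operator H1 H1) (B : operator H2 H1) (D : operator H2 H2)
    (qa : qform R H1) (qd : qform R H2) (a b dplus : R) :
  (exists x : H1, x != 0) -> (exists y : H2, y != 0) ->
  self_adjoint A -> bounded_below A ->
  linear_op B -> densely_defined B -> closable B ->
  self_adjoint D -> bounded_above D ->
  associated_form A qa -> associated_form D qd ->
  fdom qa `<=` dom (adjoint B) ->
  is_core (dom B) D \/ fdom qd `<=` dom B ->
  0 <= b ->
  (forall x, fdom qa x ->
     `|adjoint B x| ^+ 2 <= a%:C * `|x| ^+ 2 + b%:C * qa x x) ->
  max_spectrum D dplus ->
  let M := op_closure (block_op A B D) in
  let mu := dplus + b + Num.sqrt (Num.max (b * dplus + b ^+ 2 + a) 0) in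
  forall lambda : R, spectrum M lambda%:C -> mu < lambda ->
    positive_type M lambda%:C.
Proof.
move=> _ H2N0 saA bbA lB dB _ saD bbD qA qD qB coreD b0 Bab maxD M mu l specl mul.
have {}Bab x : fdom qa x -> sq (adjoint B x) <= a * sq x + b * complex.Re (qa x x).
  by move=> /Bab /Re_le; rewrite sq_norm raddfD/= Re_sq Re_realM.
have Dd := max_spectrum_bound H2N0 saD bbD maxD.
have core := core_approx qD coreD.
have domAB : dom A `<=` dom (adjoint B) by move=> x Ax; apply/qB/(dom_form qA).
have lM0 := block_op_linear saA saD lB dB domAB.
have cM0 := block_op_closable saA saD lB domAB core.
split.
  apply: contrapT => Napp; apply: specl.
  (* An orthogonal vector [v] gives [(v.1, - v.2)] in the kernel of [M - l], where the lower bound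
     forces it to vanish. *)
  apply: (not_app_spectrum_resolvent lM0 cM0 Napp) => v orth.
  have Gv := block_orth_kernel saA bbA qA saD lB dB qB core b0 Bab orth.
  have [d d0 low] := not_app_spectrum_bound lM0 cM0 Napp.
  have [Mv Mve] := op_closure_eq lM0 cM0 Gv.
  have := low _ Mv; rewrite op_shiftE Mve subrr /sq rip0l pmulr_rle0// -/(sq _) => v0.
  have : sq v <= 0 by move: v0; rewrite !sq_hsum /= sqN.
  by move=> v0'; apply/sq_eq0/eqP; rewrite eq_le sq_ge0 v0'.
have [p [q [r [p0 q0 r0 pqr]]]] := block_positivity qA b0 Bab Dd mul.
move=> w Mw /hilbert_cvgP w0 w1.
have w1' n : sq (w n) = 1.
  by apply: (@complexI R); rewrite sq_hsum rmorphD/= -!sq_norm w1.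
(* Using [r + 1] covers [r = 0]. Eventually [r |(M - l) w_n|^2 <= p / 2], which leaves at least
   [p / 2] for [q [w_n, w_n]]. *)
have r1 : 0 < 2 * (r + 1) by rewrite mulr_gt0// ltr_wpDl.
have [N HN] := w0 _ (divr_gt0 p0 r1).
apply: (@lt_le_trans _ _ (p / (2 * q))%:E); first by rewrite lte_fin divr_gt0// mulr_gt0.
apply: (@limn_einf_ge _ _ _ N) => n /HN; rewrite subr0 -/(sq _) => wn.
rewrite lee_fin Re_indef_inner ler_pdivrMr ?mulr_gt0//.
have := closure_positivity (ltW p0) (ltW q0) r0 pqr (op_closure_graph (Mw n)).
rewrite -op_shiftE w1' mulr1.
set S := sq _ in wn *; have S0 : 0 <= S by exact: sq_ge0.
move: wn; rewrite ltr_pdivlMr// => wn; nra.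
Qed.
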